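(* Let $N\ge 1$ and, for $1\le m\le N$, let $a_m,b_m\in\mathbb{R}$ with $b_m\neq 0$. Let $f_m:\mathbb{R}\to\mathbb{R}$, $f_m\in L^2(\mathbb{R})$, with $f_m$ not identically zero for at least one $m$. Let $\mathcal{K}_m:\mathbb{R}\to\mathbb{R}$, $\mathcal{K}_m\in L^1(\mathbb{R})$, with $\mathcal{K}:=\big(\sum_{m=1}^N\|\mathcal{K}_m\|_{L^1(\mathbb{R})}^2\big)^{1/2}>0$. Let $M>0$ and, for $j=1,2$, let $g_j=(g_{j,1},\dots,g_{j,N})$ with $g_{j,m}:\mathbb{R}^N\to\mathbb{R}$ differentiable, $g_{j,m}(0)=0$, $g_j$ not identically zero on $\mathbb{R}^N$, and $\sum_{m=1}^N\|\nabla g_{j,m}\|_{L^\infty(\mathbb{R}^N)}\le M$. Let $u_0\in L^2(\mathbb{R},\mathbb{R}^N)$ be the unique solution of $L_{a_m,b_m}u_{0,m}=f_m$, $1\le m\le N$. Let $0<\rho\le1$, $B_\rho:=\{u\in L^2(\mathbb{R},\mathbb{R}^N):\|u\|_{L^2(\mathbb{R},\mathbb{R}^N)}\le\rho\}$, $\varepsilon_m\ge0$, $\varepsilon:=\max_m\varepsilon_m$, and assume $$0<\varepsilon\le\frac{\rho C}{M\mathcal{K}\big(\|u_0\|_{L^2(\mathbb{R},\mathbb{R}^N)}+1\big)}.$$ For $j=1,2$ let $T_{g_j}:B_\rho\to B_\rho$ be the map $v\mapsto u$, where $u$ is the solution of $L_{a_m,b_m}u_m=\varepsilon_m\int_{\mathbb{R}}\mathcal{K}_m(x-y)g_{j,m}(u_0(y)+v(y))dy$,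 $1\le m\le N$, let $u_{p,j}$ be the unique fixed point of $T_{g_j}$ in $B_\rho$, and set $u_j:=u_0+u_{p,j}$. Let $\sigma:=\frac{\varepsilon M\mathcal{K}}{C}$. Then $$\|u_1-u_2\|_{L^2(\mathbb{R},\mathbb{R}^N)}\le\frac{\varepsilon}{1-\sigma}\,\frac{\mathcal{K}}{C}\big(\|u_0\|_{L^2(\mathbb{R},\mathbb{R}^N)}+1\big)\sum_{m=1}^N\|\nabla g_{1,m}-\nabla g_{2,m}\|_{L^\infty(\mathbb{R}^N)}.$$
   Context: Fourier transform: $\widehat{\phi}(p)=\frac{1}{\sqrt{2\pi}}\int_{\mathbb{R}}\phi(x)e^{-ipx}dx$. The logarithmic Laplacian $\ln(-\frac{d^2}{dx^2})$ is the operator with Fourier symbol $2\ln|p|$. For $a,b\in\mathbb{R}$, $b\ne0$, the operator $L_{a,b}:=\frac12\ln\big(-\frac{d^2}{dx^2}\big)-b\frac{d}{dx}-a$ on $L^2(\mathbb{R})$ has Fourier symbol $\lambda_{a,b}(p)=\ln\big(\frac{|p|}{e^{a}}\big)-ibp$; an equation $L_{a,b}w=h$ with $w,h\in L^2(\mathbb{R})$ means $\lambda_{a,b}(p)\widehat{w}(p)=\widehat{h}(p)$ for a.e. $p$. $C>0$ is a constant with $|\lambda_{a_m,b_m}(p)|\ge C$ for all $p\in\mathbb{R}$ and all $1\le m\le N$. For $u=(u_1,\dots,u_N)^T$, $\|u\|_{L^2(\mathbb{R},\mathbb{R}^N)}^2:=\sum_m\|u_m\|_{L^2(\mathbb{R})}^2$.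 $\|\cdot\|_{L^\infty(\mathbb{R}^N)}$ of a gradient is the sup norm of its Euclidean length. Under these hypotheses (a known result) each $T_{g_j}$ is a well-defined strict contraction of $B_\rho$ into itself, so $u_{p,j}$ exists and is unique, and $\sigma<1$. *)

(* Defs.v *)
From HB Require Import structures.
From mathcomp Require Import all_boot all_order all_algebra.
From mathcomp Require Import all_classical all_reals all_analysis.
Set Implicit Arguments. Unset Strict Implicit. Unset Printing Implicit Defensive.
Import Order.TTheory GRing.Theory Num.Theory numFieldNormedType.Exports.
Local Open Scope classical_set_scope.
Local Open Scope ring_scope.

Section Defs.
Variable R : realType.
Notation leb := (@lebesgue_measure R).

Definition L2norm (f : R -> R) : \bar R := 'N[leb]_2%:E[EFin \o f].
Definition L1norm (f : R -> R) : \bar R := 'N[leb]_1%:E[EFin \o f].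

Definition inL2 (f : R -> R) : Prop :=
  measurable_fun setT f /\ (L2norm f < +oo)%E.
Definition inL1 (f : R -> R) : Prop :=
  measurable_fun setT f /\ (L1norm f < +oo)%E.

Definition L2vnorm (N : nat) (u : 'I_N -> R -> R) : R :=
  Num.sqrt (\sum_(m < N) (fine (L2norm (u m))) ^+ 2).

(* Truncated Fourier transform (1/sqrt(2 pi)) int_{-T}^{T} w(x) e^{-ipx} dx,
   split into real and imaginary parts. *)
Definition FT_trunc_re (w : R -> R) (T : R) (p : R) : R :=
  (Num.sqrt (2 * pi))^-1 * Rintegral leb `[- T, T] (fun x => w x * cos (p * x)).
Definition FT_trunc_im (w : R -> R) (T : R) (p : R) : R :=
  - ((Num.sqrt (2 * pi))^-1 * Rintegral leb `[- T, T] (fun x => w x * sin (p * x))).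

(* (Wr + i Wi) is the L^2 (Fourier-Plancherel) transform of w: the L^2 limit
   of the truncated transforms as T -> +oo. *)
Definition is_FT (w Wr Wi : R -> R) : Prop :=
  inL2 Wr /\ inL2 Wi /\
  (L2norm (fun p => FT_trunc_re w T p - Wr p)) @[T --> +oo] --> 0%E /\
  (L2norm (fun p => FT_trunc_im w T p - Wi p)) @[T --> +oo] --> 0%E.

(* Symbol lambda_{a,b}(p) = ln(|p|/e^a) - i b p *)
Definition lam_re (a : R) (p : R) : R := ln (`|p| / expR a).
Definition lam_im (b : R) (p : R) : R := - (b * p).
Definition lam_abs (a b : R) (p : R) : R :=
  Num.sqrt (lam_re a p ^+ 2 + lam_im b p ^+ 2).

(* L_{a,b} w = h with w, h in L^2: lambda(p) w^(p) = h^(p) for a.e. p *)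
Definition solves_L (a b : R) (w h : R -> R) : Prop :=
  inL2 w /\ inL2 h /\
  exists Wr Wi Hr Hi : R -> R,
    is_FT w Wr Wi /\ is_FT h Hr Hi /\
    {ae leb, forall p,
      lam_re a p * Wr p - lam_im b p * Wi p = Hr p /\
      lam_re a p * Wi p + lam_im b p * Wr p = Hi p}.

Definition convol (K G : R -> R) (x : R) : R :=
  Rintegral leb setT (fun y => K (x - y) * G y).

Definition partial (N : nat) (G : 'rV[R]_N -> R) (i : 'I_N) (x : 'rV[R]_N) : R :=
  'D_(delta_mx 0 i) G x.

Definition supnorm_vec (N : nat) (F : 'rV[R]_N -> 'I_N -> R) : \bar R :=
  ereal_sup [set (Num.sqrt (\sum_(i < N) F x i ^+ 2))%:E | x in [set: 'rV[R]_N]].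

Definition grad_supnorm (N : nat) (G : 'rV[R]_N -> R) : \bar R :=
  supnorm_vec (fun x i => partial G i x).

Definition grad_diff_supnorm (N : nat) (G1 G2 : 'rV[R]_N -> R) : \bar R :=
  supnorm_vec (fun x i => partial G1 i x - partial G2 i x).

End Defs.

(* Main.v *)
(** Write [w] for the difference of the two fixed points. Each component solves
    [L w_m = eps_m K_m * (g_1(u_1) - g_2(u_2))]. By Plancherel and
    [|lambda| >= C], inverting [L] costs a factor [1 / C] in [L^2]; by Young's
    inequality the convolution costs [||K_m||_1]; and the mean value theorem gives
    [|g_1(u_1) - g_2(u_2)| <= ||grad g_1|| |w| + ||grad (g_1 - g_2)|| |u_2|].
    Hence [C ||w|| <= e Kc (M ||w|| + D ||u_2||)], which is solved for [||w||].

    The data only force [sigma <= 1]: as [f] may vanish almost everywhere,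
    [sigma = 1] is possible, with [u_0 = 0] almost everywhere; the stated bound
    is then [0], because [0^-1 = 0]. In that case [C ||u_p|| = ||h||] for the
    source [h], so [u_p = 0], since [|lambda| = C] only on a null set of
    frequencies.

    Plancherel is proved by Abel summation: damping [|phi^|^2] by
    [exp (- d |p|)] turns its integral into the quadratic form of the Poisson
    kernel, an approximate identity as [d] tends to [0]. *)
Require Import Defs.
From HB Require Import structures.
From mathcomp Require Import all_boot all_order all_algebra.
From mathcomp Require Import all_classical all_reals all_analysis.
From mathcomp Require Import measurable_realfun ring lra.
Import Order.TTheory GRing.Theory Num.Theory numFieldNormedType.Exports.
Local Open Scope classical_set_scope.
Local Open Scope ring_scope.
Set Implicit Arguments. Unset Strict Implicit. Unset Printing Implicit Defensive.

(** * Square-integrable functions *)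

(** The transform is known only as an L^2 limit of truncated integrals, so Plancherel has to be
    reached from integrable functions, and there the two inequalities differ in reach. The upper one
    is a Schur test, valid for every integrable [phi]. The lower one rests on continuity of
    translations in L^1; a sup bound on [phi] converts that into a statement about squares, and
    compact support gives uniformity in [x], so [phi] has to be bounded with compact support. A
    truncation of [w] has compact support but may be unbounded. The lower bound is therefore applied
    to a truncation that is also cut off in height, and the transform of what was removed is
    controlled by the upper bound.

    A second obstacle is that [convol] is a total real function: where its integral diverges it
    takes a default value, so it is additive only almost everywhere. This is why Young's inequality
    is proved directly for a difference of two convolutions. *)

Section reflection.
Context {R : realType}.
Local Notation mu := (@lebesgue_measure R).

(** By uniqueness of Lebesgue measure, half-open intervals suffice. Reflection moves the closed end
    to the other side, which leaves the length unchanged. *)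
Lemma lebesgue_measure_reflection (c : R) (A : set R) : measurable A ->
  pushforward mu ((fun y => c - y) : _ -> measurableTypeR R) A = mu A.
Proof.
move=> mA.
have mf : measurable_fun setT ((fun y => c - y) : measurableTypeR R -> measurableTypeR R).
  by apply: measurable_funB => //; exact: measurable_cst.
pose mf' := isMeasurableFun.Build _ _ _ _ _ mf.
pose f : {mfun _ >-> _} := HB.pack ((fun y => c - y) : measurableTypeR R -> measurableTypeR R) mf'.
apply/esym; rewrite -[LHS]/(mu A) -[RHS]/(pushforward mu f A).
apply: lebesgue_measure_unique => //= _ [[a b]] _ <-.
rewrite /pushforward/=.
have -> : (fun y => c - y) @^-1` `]a, b] = `[c - b, c - a[%classic.
  by apply/seteqP; split => y /=; rewrite !in_itv/= => /andP[? ?];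
    apply/andP; split; lra.
by rewrite !lebesgue_measure_itv/= !lte_fin ltrD2l ltrN2; case: ifP => // _;
  rewrite -!EFinB; congr EFin; ring.
Qed.

Lemma ge0_integral_reflection (c : R) (f : R -> \bar R) :
  measurable_fun setT f -> (forall x, 0 <= f x)%E ->
  (\int[mu]_x f (c - x)%R = \int[mu]_x f x)%E.
Proof.
move=> mf f0.
have mg : measurable_fun setT ((fun y => c - y) : measurableTypeR R -> measurableTypeR R).
  by apply: measurable_funB => //; exact: measurable_cst.
have := @ge0_integral_pushforward _ _ _ _ R _ mg mu setT f measurableT mf (fun y _ => f0 y).
rewrite preimage_setT => <-.
by apply: eq_measure_integral => //= A mA _; exact: lebesgue_measure_reflection.
Qed.

(** A translation is a composite of two reflections: [f (x - c)] is [g (c - x)] for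
    [g x = f (0 - x)]. *)
Lemma ge0_integral_translation (c : R) (f : R -> \bar R) :
  measurable_fun setT f -> (forall x, 0 <= f x)%E ->
  (\int[mu]_x f (x - c)%R = \int[mu]_x f x)%E.
Proof.
move=> mf f0; pose g x := f (0 - x).
have mg : measurable_fun setT g.
  apply: measurableT_comp => //.
  by apply: measurable_funB => //; exact: measurable_cst.
rewrite -(ge0_integral_reflection 0 mf f0) -/g -(ge0_integral_reflection c mg)//.
  by apply: eq_integral => x _; rewrite /g; congr f; ring.
by move=> x; exact: f0.
Qed.

End reflection.

Section square_integral.
Context {R : realType}.
Local Notation mu := (@lebesgue_measure R).
Implicit Types f g : R -> R.

(** The squared norm, free of roots: it adds up over real and imaginary parts and over components,
    and may be infinite. *)
Definition sqint f : \bar R := (\int[mu]_x (f x ^+ 2)%:E)%E.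

Lemma sqint_ge0 f : (0 <= sqint f)%E.
Proof. by apply: integral_ge0 => x _; rewrite lee_fin sqr_ge0. Qed.

Lemma measurable_sqr f : measurable_fun setT f ->
  measurable_fun setT (fun x => (f x ^+ 2)%:E).
Proof. by move=> mf; apply/measurable_EFinP; exact: measurable_funX. Qed.

Lemma L2norm_ge0 f : (0 <= L2norm f)%E.
Proof. exact: Lnorm_ge0. Qed.

Lemma L2norm_sqr f : (L2norm f * L2norm f = sqint f)%E.
Proof.
have := @poweR_Lnorm _ _ _ mu (EFin \o f) 2 _; rewrite pnatr_eq0 => /(_ isT).
rewrite -/(L2norm f) => N2.
have -> : (L2norm f * L2norm f = L2norm f `^ 2)%E.
  have := L2norm_ge0 f; case: (L2norm f) => [r| |]//=.
    by rewrite lee_fin => r0; rewrite -EFinM powR_mulrn// expr2.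
  by rewrite mulyy pnatr_eq0.
rewrite N2; apply: eq_integral => x _ /=.
by rewrite powR_mulrn// real_normK ?num_real.
Qed.

Lemma L2norm_lty f : (L2norm f < +oo)%E <-> (sqint f < +oo)%E.
Proof.
rewrite -L2norm_sqr; have := L2norm_ge0 f; case: (L2norm f) => [r| |]//.
by move=> _; split => // _; exact: ltry.
Qed.

Lemma fine_L2norm_sqr f : fine (L2norm f) ^+ 2 = fine (sqint f).
Proof.
rewrite -L2norm_sqr; have := L2norm_ge0 f; case: (L2norm f) => [r| |]//=.
by rewrite expr0n.
Qed.

Lemma inL2P f : inL2 f <-> measurable_fun setT f /\ (sqint f < +oo)%E.
Proof. by split=> -[mf] /L2norm_lty. Qed.

Lemma sqint_fin_num f : (sqint f < +oo)%E -> sqint f \is a fin_num.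
Proof. by move=> fy; rewrite ge0_fin_numE// sqint_ge0. Qed.

Lemma fin_num_sqintD f g : (sqint f < +oo)%E -> (sqint g < +oo)%E ->
  (sqint f + sqint g)%E \is a fin_num.
Proof. by move=> fy gy; rewrite fin_numD !sqint_fin_num. Qed.

Lemma le_sqint f g : measurable_fun setT f -> measurable_fun setT g ->
  (forall x, `|f x| <= `|g x|) -> (sqint f <= sqint g)%E.
Proof.
move=> mf mg fg; apply: ge0_le_integral => //.
- by move=> x _; rewrite lee_fin sqr_ge0.
- exact: measurable_sqr.
- exact: measurable_sqr.
- by move=> x _; rewrite lee_fin -(real_normK (num_real (f x)))
    -(real_normK (num_real (g x))) lerXn2r// nnegrE normr_ge0.
Qed.

Lemma sqintZ c f : measurable_fun setT f ->
  sqint (fun x => c * f x) = ((c ^+ 2)%:E * sqint f)%E.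
Proof.
move=> mf; rewrite /sqint -ge0_integralZl_EFin ?sqr_ge0//.
- by apply: eq_integral => x _; rewrite exprMn EFinM.
- by move=> x _; rewrite lee_fin sqr_ge0.
- exact: measurable_sqr.
Qed.

Lemma sqintN f : sqint (fun x => - f x) = sqint f.
Proof. by apply: eq_integral => x _; rewrite sqrrN. Qed.

(* AM-GM with a free weight; letting [t] tend to [0] recovers the triangle
   inequality, and finite additivity of integrals suffices to use it. *)
Lemma sqrD_weighted (t x y : R) : 0 < t ->
  (x + y) ^+ 2 <= (1 + t) * x ^+ 2 + (1 + t^-1) * y ^+ 2.
Proof.
move=> t0; rewrite -subr_ge0.
have -> : (1 + t) * x ^+ 2 + (1 + t^-1) * y ^+ 2 - (x + y) ^+ 2 =
   t * (x - t^-1 * y) ^+ 2 by field; rewrite gt_eqF.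
by rewrite mulr_ge0 ?sqr_ge0// ltW.
Qed.

Lemma sqintD_weighted (t : R) f g : 0 < t ->
  measurable_fun setT f -> measurable_fun setT g ->
  (sqint (fun x => f x + g x)%R
    <= (1 + t)%:E * sqint f + (1 + t^-1)%:E * sqint g)%E.
Proof.
move=> t0 mf mg.
have t1 : 0 <= 1 + t by rewrite addr_ge0// ltW.
have t2 : 0 <= 1 + t^-1 by rewrite addr_ge0// invr_ge0 ltW.
rewrite -!ge0_integralZl_EFin//; last 4 first.
- by move=> x _; rewrite lee_fin sqr_ge0.
- exact: measurable_sqr.
- by move=> x _; rewrite lee_fin sqr_ge0.
- exact: measurable_sqr.
rewrite -ge0_integralD//; last 4 first.
- by move=> x _; rewrite mule_ge0// lee_fin ?sqr_ge0.
- by apply: measurable_funeM; exact: measurable_sqr.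
- by move=> x _; rewrite mule_ge0// lee_fin ?sqr_ge0.
- by apply: measurable_funeM; exact: measurable_sqr.
apply: ge0_le_integral => //.
- by move=> x _; rewrite lee_fin sqr_ge0.
- by apply: measurable_sqr; exact: measurable_funD.
- by apply: emeasurable_funD; apply: measurable_funeM; exact: measurable_sqr.
- by move=> x _; rewrite -!EFinM -EFinD lee_fin sqrD_weighted.
Qed.

Lemma sqintD_lty f g : measurable_fun setT f -> measurable_fun setT g ->
  (sqint f < +oo)%E -> (sqint g < +oo)%E ->
  (sqint (fun x => f x + g x)%R < +oo)%E.
Proof.
move=> mf mg fy gy.
apply: (le_lt_trans (@sqintD_weighted 1 _ _ ltr01 mf mg)).
by rewrite lte_add_pinfty// lte_mul_pinfty// ?lee_fin ?addr_ge0 ?invr_ge0//.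
Qed.

Lemma inL2D f g : inL2 f -> inL2 g -> inL2 (fun x => f x + g x).
Proof.
move=> /inL2P[mf fy] /inL2P[mg gy]; apply/inL2P; split.
  exact: measurable_funD.
exact: sqintD_lty.
Qed.

Lemma inL2Z c f : inL2 f -> inL2 (fun x => c * f x).
Proof.
move=> /inL2P[mf fy]; apply/inL2P; split; first exact: measurable_funM.
by rewrite sqintZ// lte_mul_pinfty// lee_fin sqr_ge0.
Qed.

Lemma inL2N f : inL2 f -> inL2 (fun x => - f x).
Proof.
move=> /inL2P[mf fy]; apply/inL2P; split; first exact: measurable_funN.
by rewrite sqintN.
Qed.

Lemma inL2B f g : inL2 f -> inL2 g -> inL2 (fun x => f x - g x).
Proof. by move=> f2 g2; apply: inL2D => //; exact: inL2N. Qed.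

Lemma inL2_le f g : measurable_fun setT f -> inL2 g ->
  (forall x, `|f x| <= `|g x|) -> inL2 f.
Proof.
move=> mf /inL2P[mg gy] fg; apply/inL2P; split => //.
exact: le_lt_trans (le_sqint mf mg fg) gy.
Qed.

Lemma fine_sqint_ge0 f : 0 <= fine (sqint f).
Proof. by rewrite fine_ge0// sqint_ge0. Qed.

Lemma fine_sqintD_weighted (t : R) f g : 0 < t -> inL2 f -> inL2 g ->
  fine (sqint (fun x => f x + g x)) <=
    (1 + t) * fine (sqint f) + (1 + t^-1) * fine (sqint g).
Proof.
move=> t0 f2 g2; have /inL2P[_ fgy] := inL2D f2 g2.
move: f2 g2 => /inL2P[mf fy] /inL2P[mg gy].
have := sqintD_weighted t0 mf mg.
by rewrite -[sqint f]fineK ?sqint_fin_num// -[sqint g]fineK ?sqint_fin_num//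
  -[sqint (fun x => _)]fineK ?sqint_fin_num//.
Qed.

Lemma fine_sqint_le f g : measurable_fun setT f -> inL2 g ->
  (forall x, `|f x| <= `|g x|) -> fine (sqint f) <= fine (sqint g).
Proof.
move=> mf g2 fg; have /inL2P[_ fy] := inL2_le mf g2 fg.
by move: g2 => /inL2P[mg gy]; rewrite fine_le ?sqint_fin_num// le_sqint.
Qed.

Lemma fine_L2normD f g : inL2 f -> inL2 g ->
  fine (L2norm (fun x => f x + g x)) <= fine (L2norm f) + fine (L2norm g).
Proof.
move=> f2 g2; have [_ fgy] := inL2D f2 g2.
case: f2 g2 => mf fy [mg gy].
rewrite -fineD ?ge0_fin_numE ?L2norm_ge0//; apply: fine_le.
- by rewrite ge0_fin_numE// L2norm_ge0.
- by rewrite fin_numD !ge0_fin_numE ?L2norm_ge0// fy gy.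
- by apply: minkowski_EFin => //; rewrite ler1n.
Qed.

Lemma fine_L2norm_le f g : measurable_fun setT f -> inL2 g ->
  (forall x, `|f x| <= `|g x|) -> fine (L2norm f) <= fine (L2norm g).
Proof.
move=> mf g2 fg; have f2 := inL2_le mf g2 fg.
have /inL2P[mg gy] := g2; have /inL2P[_ fy] := f2.
rewrite -ler_sqr ?nnegrE ?fine_ge0 ?L2norm_ge0// !fine_L2norm_sqr.
by rewrite fine_le ?sqint_fin_num// le_sqint.
Qed.

Lemma fine_L2normZ c f : 0 <= c -> measurable_fun setT f ->
  fine (L2norm (fun x => c * f x)) = c * fine (L2norm f).
Proof.
move=> c0 mf; apply/eqP; rewrite -(@eqrXn2 _ 2)// ?mulr_ge0 ?fine_ge0 ?L2norm_ge0//.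
rewrite exprMn !fine_L2norm_sqr sqintZ//.
have := sqint_ge0 f; case: (sqint f) => [r| |]//= _.
(* The infinite case: [fine] sends infinity to [0], so both sides are [0] whether or not [c]
   vanishes. *)
rewrite mulr0; have [->|cn0] := eqVneq c 0; first by rewrite expr0n/= mul0e.
by rewrite gt0_muley ?lte_fin ?exprn_gt0 ?lt0r ?cn0.
Qed.

End square_integral.

(** * The Poisson kernel *)

Section poisson_kernel.
Context {R : realType}.
Local Notation mu := (@lebesgue_measure R).

Implicit Types d z p x : R.

Definition damp (d p : R) : R := expR (- (d * `|p|)).
(** The Poisson kernel of the half-plane without its factor [1 / (2 * pi)]: it is the cosine
    transform of [damp d] and has total mass [2 * pi]. *)
Definition poisson (d z : R) : R := 2 * d / (d ^+ 2 + z ^+ 2).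

Lemma is_derive_mull (c x : R) : is_derive x 1 (fun q => c * q) c.
Proof.
have := is_deriveZ c (is_derive_id x (1 : R)).
by rewrite /GRing.scale/= mulr1.
Qed.

Lemma is_derive_mulr (c x : R) : is_derive x 1 (fun q => q * c) c.
Proof.
rewrite (_ : (fun q => q * c) = (fun q => c * q)); first exact: is_derive_mull.
by apply/funext => q; rewrite mulrC.
Qed.

Lemma is_derive_continuous (f : R -> R) (x l : R) :
  is_derive x 1 f l -> {for x, continuous f}.
Proof.
by move=> df; apply: differentiable_continuous; apply/derivable1_diffP; exact: ex_derive.
Qed.

Lemma damp_ge0 d p : 0 <= damp d p. Proof. exact: expR_ge0. Qed.

Lemma damp_le1 d p : 0 <= d -> damp d p <= 1.
Proof. by move=> d0; rewrite /damp -expR0 ler_expR oppr_le0 mulr_ge0. Qed.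

Lemma continuous_damp d : continuous (damp d).
Proof.
move=> x; apply: continuous_comp; last exact: continuous_expR.
apply: continuousN; apply: continuousM; first exact: cvg_cst.
exact: norm_continuous.
Qed.

Lemma measurable_damp d : measurable_fun setT (damp d).
Proof. by apply: continuous_measurable_fun; exact: continuous_damp. Qed.

Lemma continuous_cosM (z : R) : continuous (fun p : R => cos (p * z)).
Proof.
move=> x; apply: continuous_comp; last exact: continuous_cos.
exact: is_derive_continuous (is_derive_mulr z x).
Qed.

Lemma cvg_expR_damp (d : R) : 0 < d -> expR (- (d * p)) @[p --> +oo] --> (0 : R).
Proof.
move=> d0.
apply: (@cvg_comp _ _ _ (fun p => d * p) (fun x => expR (- x)) _ +oo); last exact: cvgr_expR.
by apply: gt0_cvgMry d0 _; exact: cvg_id.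
Qed.

(** An antiderivative of the [f] below that vanishes at infinity. The summand [1] next to the cosine
    makes [f] nonnegative, as the fundamental theorem on a half-line asks; its contribution [2 / d]
    to the integral over the whole line is removed in [Rintegral_damp_cos]. *)
Let F (d z p : R) : R := expR (- (d * p)) *
  ((z * sin (p * z) - d * cos (p * z)) / (d ^+ 2 + z ^+ 2) - d^-1).
Let f (d z p : R) : R := expR (- (d * p)) * (1 + cos (p * z)).

Let dz_neq0 (d z : R) : 0 < d -> d ^+ 2 + z ^+ 2 != 0.
Proof. by move=> d0; rewrite gt_eqF// ltr_pwDl ?sqr_ge0// exprn_gt0. Qed.

Let is_derive_F d z x : 0 < d -> is_derive x 1 (F d z) (f d z x).
Proof.
move=> d0.
have De : is_derive x 1 (fun q => expR (- (d * q))) (expR (- (d * x)) * - d).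
  apply: (@is_derive1_comp _ expR (fun q => - (d * q))).
  exact: is_deriveN (is_derive_mull d x).
have Ds : is_derive x 1 (fun q => sin (q * z)) (cos (x * z) * z).
  by apply: (@is_derive1_comp _ sin (fun q => q * z)); exact: is_derive_mulr.
have Dc : is_derive x 1 (fun q => cos (q * z)) (- sin (x * z) * z).
  by apply: (@is_derive1_comp _ cos (fun q => q * z)); exact: is_derive_mulr.
have D := is_deriveM De (is_deriveB (is_deriveZ (d ^+ 2 + z ^+ 2)^-1
  (is_deriveB (is_deriveZ z Ds) (is_deriveZ d Dc))) (is_derive_cst d^-1 x 1)).
rewrite (_ : F d z = (fun q => expR (- (d * q))) *
  ((d ^+ 2 + z ^+ 2)^-1 \*: (z \*: (fun q => sin (q * z)) -
     d \*: (fun q => cos (q * z))) - cst d^-1)); last first.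
  by apply/funext => q; rewrite /F !fctE /GRing.scale/=; congr (_ * (_ - _)); rewrite mulrC.
apply: (is_derive_eq D); rewrite /f !fctE /GRing.scale/= /GRing.scale/=.
by field; rewrite gt_eqF//= dz_neq0.
Qed.

Let cvg_F d z : 0 < d -> F d z p @[p --> +oo] --> 0.
Proof.
move=> d0; pose c := (`|z| + d) / (d ^+ 2 + z ^+ 2) + d^-1.
have c0 : 0 < d ^+ 2 + z ^+ 2 by rewrite lt0r dz_neq0// addr_ge0 ?sqr_ge0.
have cv : expR (- (d * p)) * c @[p --> +oo] --> 0.
  by rewrite -[X in _ --> X](mul0r c); apply: cvgM; [exact: cvg_expR_damp|exact: cvg_cst].
apply: norm_cvg0; apply: (@squeeze_cvgr _ _ _ _ (cst 0) _ _ _ _ _ cv); last exact: cvg_cst.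
apply/nearW => p /=; rewrite normr_ge0/= normrM (ger0_norm (expR_ge0 _)).
rewrite ler_wpM2l ?expR_ge0// /c (le_trans (ler_normB _ _))// lerD//; last first.
  by rewrite ger0_norm// invr_ge0 ltW.
have c0' : 0 <= (d ^+ 2 + z ^+ 2)^-1 by rewrite invr_ge0 ltW.
rewrite normrM (ger0_norm c0') ler_wpM2r//.
rewrite (le_trans (ler_normB _ _))// !normrM (gtr0_norm d0) lerD//.
  by rewrite ler_piMr// ler_norml sin_geN1 sin_le1.
by rewrite ler_piMr ?(ltW d0)// ler_norml cos_geN1 cos_le1.
Qed.

Let integral_f d z : 0 < d ->
  (\int[mu]_(p in `[0%R, +oo[) (f d z p)%:E = (d / (d ^+ 2 + z ^+ 2) + d^-1)%:E)%E.
Proof.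
move=> d0.
have cF x : {for x, continuous (F d z)} by exact: is_derive_continuous (is_derive_F _ _ d0).
rewrite (@ge0_continuous_FTC2y _ _ (F d z) _ 0)//.
- rewrite -EFinD; congr EFin; rewrite /F !mul0r mulr0 oppr0 expR0 sin0 cos0.
  by rewrite sub0r mulr0 sub0r !mul1r mulr1 opprB addrC mulNr opprK.
- by move=> x _; rewrite /f mulr_ge0 ?expR_ge0//; have := cos_geN1 (x * z); lra.
- apply: continuous_subspaceT => x.
  apply: (@continuousM _ _ (fun p => expR (- (d * p))) (fun p => 1 + cos (p * z))).
    apply: continuous_comp; last exact: continuous_expR.
    exact: (is_derive_continuous (is_deriveN (is_derive_mull d x))).
  by apply: continuousD; [exact: cvg_cst|exact: continuous_cosM].
- exact: cvg_F.
- by apply: cvg_at_right_filter; exact: cF.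
- by move=> x _; rewrite derive1E; have := is_derive_F z x d0 => ?; exact: derive_val.
Qed.

Lemma integral_damp_1Dcos d z : 0 < d ->
  (\int[mu]_p (damp d p * (1 + cos (p * z)))%:E = (poisson d z + 2 / d)%:E)%E.
Proof.
move=> d0; rewrite ge0_symfun_integralT; last 3 first.
- by move=> x; rewrite mulr_ge0 ?damp_ge0//; have := cos_geN1 (x * z); lra.
- move=> x; apply: continuousM; first exact: continuous_damp.
  by apply: continuousD; [exact: cvg_cst|exact: continuous_cosM].
- by move=> x /=; rewrite /damp normrN mulNr cosN.
rewrite -set_itvcy [X in (_ * X)%E](_ : _ =
    \int[mu]_(p in `[0%R, +oo[) (f d z p)%:E)%E; last first.
  apply: eq_integral.
  by move=> p; rewrite inE/= in_itv/= andbT => p0; rewrite /damp ger0_norm.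
by rewrite integral_f// -EFinM; congr EFin; rewrite /poisson; field; rewrite gt_eqF//= dz_neq0.
Qed.

(** The case [z = 0] of the previous integral, where [1 + cos] is the constant [2]. *)
Lemma integral_damp d : 0 < d -> (\int[mu]_p (damp d p)%:E = (2 / d)%:E)%E.
Proof.
move=> d0; have := integral_damp_1Dcos 0 d0.
under eq_integral do rewrite mulr0 cos0 mulrC EFinM.
rewrite ge0_integralZl_EFin//; last 2 first.
- by move=> x _; rewrite lee_fin damp_ge0.
- by apply/measurable_EFinP; exact: measurable_damp.
move=> h; have : ((1 / 2)%:E * ((1 + 1)%:E * \int[mu]_p (damp d p)%:E) = (2 / d)%:E)%E.
  rewrite h -EFinM; congr EFin; rewrite /poisson expr0n/= addr0.
  by field; rewrite gt_eqF.
by rewrite muleA -EFinM (_ : 1 / 2 * (1 + 1) = 1 :> R) ?mul1e//; field.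
Qed.

Lemma integrable_damp d : 0 < d -> mu.-integrable setT (EFin \o damp d).
Proof.
move=> d0; apply/integrableP; split.
  by apply/measurable_EFinP; exact: measurable_damp.
under eq_integral => x _ do rewrite /= ger0_norm ?damp_ge0//.
by rewrite integral_damp// ltry.
Qed.

Lemma Rintegral_damp_cos d z : 0 < d ->
  Rintegral mu setT (fun p => damp d p * cos (p * z)) = poisson d z.
Proof.
move=> d0.
have mcos : measurable_fun setT (fun p => cos (p * z)).
  by apply: continuous_measurable_fun; exact: continuous_cosM.
have ic : mu.-integrable setT (EFin \o (fun p => damp d p * cos (p * z))).
  apply: le_integrable (integrable_damp d0) => //.
    by apply/measurable_EFinP; apply: measurable_funM => //; exact: measurable_damp.
  move=> x _ /=; rewrite lee_fin normrM (@ger0_norm _ (damp d x)) ?damp_ge0//.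
  by rewrite ler_piMr ?damp_ge0// ler_norml cos_geN1 cos_le1.
have := congr1 fine (integral_damp_1Dcos z d0).
rewrite -[fine (integral _ _ _)]/(Rintegral mu setT _).
under eq_Rintegral do rewrite mulrDr mulr1.
rewrite RintegralD//; last exact: integrable_damp.
rewrite {1}/Rintegral integral_damp//=.
by rewrite addrC => /addIr.
Qed.

Lemma poisson_ge0 d z : 0 <= d -> 0 <= poisson d z.
Proof. by move=> d0; rewrite /poisson divr_ge0 ?mulr_ge0 ?addr_ge0 ?sqr_ge0. Qed.

Lemma continuous_poisson d : 0 < d -> continuous (poisson d).
Proof.
move=> d0 x.
apply: (@continuousM _ _ (cst (2 * d)) (fun z => (d ^+ 2 + z ^+ 2)^-1)).
  exact: cvg_cst.
apply: (@continuousV _ _ (fun z => d ^+ 2 + z ^+ 2)); first exact: dz_neq0.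
by apply: continuousD; [exact: cvg_cst|exact: exprn_continuous].
Qed.

Lemma measurable_poisson d : 0 < d -> measurable_fun setT (poisson d).
Proof. by move=> d0; apply: continuous_measurable_fun; exact: continuous_poisson. Qed.

Lemma integral_poisson d : 0 < d ->
  (\int[mu]_z (poisson d z)%:E = (2 * pi)%:E)%E.
Proof.
move=> d0; rewrite ge0_symfun_integralT; last 3 first.
- by move=> x; rewrite poisson_ge0// ltW.
- exact: continuous_poisson.
- by move=> x /=; rewrite /poisson sqrrN.
pose G z := 2 * atan (d^-1 * z).
have dG x : is_derive x 1 G (poisson d x).
  have Da : is_derive x 1 (fun q => atan (d^-1 * q)) ((1 + (d^-1 * x) ^+ 2)^-1 * d^-1).
    by apply: (@is_derive1_comp _ atan (fun q => d^-1 * q)); exact: is_derive_mull.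
  apply: (is_derive_eq (is_deriveZ 2 Da)); rewrite /poisson /GRing.scale/=.
  by field; rewrite dz_neq0// gt_eqF.
rewrite -set_itvcy (@ge0_continuous_FTC2y _ _ G _ pi)//.
- by rewrite /G mulr0 atan0 mulr0 sube0 -EFinM.
- by move=> x _; rewrite poisson_ge0// ltW.
- exact: continuous_subspaceT (continuous_poisson d0).
- rewrite /G -[X in _ --> X](@divfK _ 2)// [X in _ --> X]mulrC.
  apply: cvgM; first exact: cvg_cst.
  apply: (@cvg_comp _ _ _ (fun p => d^-1 * p) atan _ +oo); last exact: cvgy_atan.
  by apply: gt0_cvgMry; [rewrite invr_gt0|exact: cvg_id].
- by apply: cvg_at_right_filter; exact: is_derive_continuous (dG 0).
- by move=> x _; rewrite derive1E; have ? := dG x; exact: derive_val.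
Qed.

End poisson_kernel.

(** * Damped Fourier integrals *)

Section real_integrals.
Context {R : realType}.
Local Notation mu := (@lebesgue_measure R).

(** When the integral of [f] is infinite, [Rintegral] takes the value [0] and the bound is trivial.
    Measurability alone thus suffices, which lets the bound be used before integrability is
    known. *)
Lemma normr_Rintegral_le (f : R -> R) : measurable_fun setT f ->
  (`|Rintegral mu setT f|%:E <= \int[mu]_x `|f x|%:E)%E.
Proof.
move=> mf; rewrite /Rintegral.
have h := @le_abse_integral _ _ _ mu setT (EFin \o f) measurableT
  ((measurable_EFinP _ _).2 mf).
apply: le_trans h.
by case: (\int[mu]_x (f x)%:E)%E => [r| |] //=; rewrite normr0 leey.
Qed.

Lemma EFin_Rintegral (f : R -> R) : mu.-integrable setT (EFin \o f) ->
  (Rintegral mu setT f)%:E = (\int[mu]_x (f x)%:E)%E.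
Proof. by move=> fi; rewrite fineK//; exact: integrable_fin_num. Qed.

(** Tonelli treats the positive and the negative part separately; the integral is the difference of
    the two, whatever values these take. *)
Lemma measurable_Rintegral (F : R -> R -> R) :
  measurable_fun setT (fun z : R * R => F z.1 z.2) ->
  measurable_fun setT (fun p => Rintegral mu setT (F p)).
Proof.
move=> mF; pose f (z : R * R) : \bar R := (F z.1 z.2)%:E.
have mf : measurable_fun setT f by exact/measurable_EFinP.
have -> : (fun p => Rintegral mu setT (F p)) = fine \o (fun p =>
    \int[mu]_x f^\+ (p, x) - \int[mu]_x f^\- (p, x))%E.
  apply/funext => p; rewrite /Rintegral integralE.
  by congr (fine (_ - _)%E); apply: eq_integral => x _; rewrite unlock.
apply: (measurableT_comp (fine_measurable measurableT)).
apply: emeasurable_funB.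
  apply: (@measurable_fun_fubini_tonelli_F _ _ _ _ R mu f^\+%E) => //.
  exact: measurable_funepos.
apply: (@measurable_fun_fubini_tonelli_F _ _ _ _ R mu f^\-%E) => //.
exact: measurable_funeneg.
Qed.

(** The product bound makes [F] integrable on the plane and on every horizontal and vertical line.
    All inner integrals are then finite, so the real-valued iterated integrals are those of Fubini's
    theorem. *)
Lemma Rintegral_swap (F : R -> R -> R) (w h : R -> R) :
  measurable_fun setT (fun z : R * R => F z.1 z.2) ->
  mu.-integrable setT (EFin \o w) -> mu.-integrable setT (EFin \o h) ->
  (forall p x, `|F p x| <= `|w p| * `|h x|) ->
  Rintegral mu setT (fun p => Rintegral mu setT (F p)) =
  Rintegral mu setT (fun x => Rintegral mu setT (F ^~ x)).
Proof.
move=> mF iw ih Fwh; pose f (z : R * R) : \bar R := (F z.1 z.2)%:E.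
have mf : measurable_fun setT f by exact/measurable_EFinP.
have mF1 p : measurable_fun setT (F p).
  exact: (measurableT_comp mF (pair1_measurable p)).
have mF2 x : measurable_fun setT (F ^~ x).
  exact: (measurableT_comp mF (pair2_measurable x)).
have iF1 p : mu.-integrable setT (EFin \o F p).
  apply: le_integrable (integrableZl measurableT (w p) ih) => //.
    by apply/measurable_EFinP; exact: mF1.
  by move=> x _; rewrite /= lee_fin normrM.
have iF2 x : mu.-integrable setT (EFin \o F ^~ x).
  apply: le_integrable (integrableZl measurableT (h x) iw) => //.
    by apply/measurable_EFinP; exact: mF2.
  by move=> p _; rewrite /= lee_fin normrM mulrC.
have /integrableP[mw wy] := iw; have /integrableP[mh hy] := ih.
have imf : (mu \x mu)%E.-integrable setT f.
  apply/integrable12ltyP => //.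
  have hy0 : (0 <= \int[mu]_x `|(h x)%:E|)%E by exact: integral_ge0.
  apply: (@le_lt_trans _ _ (\int[mu]_p ((\int[mu]_x `|(h x)%:E|) * `|(w p)%:E|))%E).
    apply: ge0_le_integral => //.
    - by move=> p _; exact: integral_ge0.
    - apply: (@measurable_fun_fubini_tonelli_F _ _ _ _ R mu (abse \o f)).
        exact: measurableT_comp.
      by move=> z; exact: abse_ge0.
    - by apply: measurable_funeM; exact: measurableT_comp.
    - move=> p _; rewrite muleC -ge0_integralZl//; last exact: measurableT_comp.
      apply: ge0_le_integral => //.
      + by apply: measurableT_comp => //; apply/measurable_EFinP; exact: mF1.
      + by apply: measurable_funeM; exact: measurableT_comp.
      + by move=> x _; rewrite /f/= -EFinM lee_fin.
  rewrite ge0_integralZl//; last exact: measurableT_comp.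
  by rewrite lte_mul_pinfty ?integral_ge0// ge0_fin_numE ?integral_ge0.
rewrite /Rintegral -!/(Rintegral _ _ _); congr fine.
under eq_integral do rewrite EFin_Rintegral//.
under [RHS]eq_integral do rewrite EFin_Rintegral//.
exact: (Fubini imf).
Qed.

End real_integrals.

(** * Damped Fourier inversion and the Poisson quadratic form *)

Section damped_fourier.
Context {R : realType}.
Local Notation mu := (@lebesgue_measure R).
Local Notation Rint := (Rintegral mu setT).
Implicit Types (d p x y z : R).
Variable phi : R -> R.
Hypothesis iphi : mu.-integrable setT (EFin \o phi).

Let mphi : measurable_fun setT phi.
Proof. by apply/measurable_EFinP; case/integrableP: iphi. Qed.

Definition fcos p := Rint (fun x => phi x * cos (p * x)).
Definition fsin p := Rint (fun x => phi x * sin (p * x)).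

Lemma integrable_mul_bounded (f h : R -> R) : mu.-integrable setT (EFin \o f) ->
  measurable_fun setT h -> (forall x, `|h x| <= 1) ->
  mu.-integrable setT (EFin \o (fun x => f x * h x)).
Proof.
move=> fi mh h1; have /integrableP[/measurable_EFinP mf _] := fi.
apply: le_integrable fi => //; first exact/measurable_EFinP/measurable_funM.
by move=> x _; rewrite /= lee_fin normrM ler_piMr.
Qed.

Lemma normr_cos_le1 x : `|cos x| <= 1.
Proof. by rewrite ler_norml cos_geN1 cos_le1. Qed.

Lemma normr_sin_le1 x : `|sin x| <= 1.
Proof. by rewrite ler_norml sin_geN1 sin_le1. Qed.

Lemma measurable_cos : measurable_fun setT (@cos R).
Proof. by apply: continuous_measurable_fun; exact: continuous_cos. Qed.

Lemma measurable_sin : measurable_fun setT (@sin R).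
Proof. by apply: continuous_measurable_fun; exact: continuous_sin. Qed.

Let mcosM p : measurable_fun setT (fun x => cos (p * x)).
Proof. by apply: measurableT_comp; [exact: measurable_cos|exact: measurable_funM]. Qed.

Let msinM p : measurable_fun setT (fun x => sin (p * x)).
Proof. by apply: measurableT_comp; [exact: measurable_sin|exact: measurable_funM]. Qed.

Let icos p : mu.-integrable setT (EFin \o (fun x => phi x * cos (p * x))).
Proof. by apply: integrable_mul_bounded => // x; exact: normr_cos_le1. Qed.

Let isin p : mu.-integrable setT (EFin \o (fun x => phi x * sin (p * x))).
Proof. by apply: integrable_mul_bounded => // x; exact: normr_sin_le1. Qed.

Lemma measurable_fcos : measurable_fun setT fcos.
Proof.
apply: (@measurable_Rintegral _ (fun p x => phi x * cos (p * x))).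
apply: measurable_funM; first exact: measurableT_comp.
by apply: (measurableT_comp measurable_cos); exact: measurable_funM.
Qed.

Lemma measurable_fsin : measurable_fun setT fsin.
Proof.
apply: (@measurable_Rintegral _ (fun p x => phi x * sin (p * x))).
apply: measurable_funM; first exact: measurableT_comp.
by apply: (measurableT_comp measurable_sin); exact: measurable_funM.
Qed.

Let N := Rint (fun x => `|phi x|).

Let N_ge0 : 0 <= N. Proof. exact: Rintegral_ge0. Qed.

Let inorm : mu.-integrable setT (EFin \o (fun x => `|phi x|)).
Proof. exact: integrable_norm. Qed.

Let dominated_le (h : R -> R) : measurable_fun setT h -> (forall x, `|h x| <= 1) ->
  `|Rint (fun x => phi x * h x)| <= N.
Proof.
move=> mh h1; have ih := integrable_mul_bounded iphi mh h1.
rewrite (le_trans (le_normr_Rintegral _ ih))// le_Rintegral//.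
  exact: (integrable_norm ih).
by move=> x _; rewrite normrM ler_piMr.
Qed.

Let fcos_le p : `|fcos p| <= N.
Proof. by apply: dominated_le => // x; exact: normr_cos_le1. Qed.

Let fsin_le p : `|fsin p| <= N.
Proof. by apply: dominated_le => // x; exact: normr_sin_le1. Qed.

(** The real part of [exp (i p x)] times the unnormalised transform at [p], that is, the integrand
    of Fourier inversion. *)
Let H p x := fcos p * cos (p * x) + fsin p * sin (p * x).

Let HE p x : H p x = Rint (fun y => phi y * cos (p * (x - y))).
Proof.
rewrite /H /fcos /fsin -!RintegralZr// -RintegralD//; last 2 first.
- by apply: (@integrable_mul_bounded _ (cst (cos (p * x))));
    [exact: icos|exact: measurable_cst|move=> ?; exact: normr_cos_le1].
- by apply: (@integrable_mul_bounded _ (cst (sin (p * x))));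
    [exact: isin|exact: measurable_cst|move=> ?; exact: normr_sin_le1].
by apply: eq_Rintegral => y _; rewrite mulrBr cosB; ring.
Qed.

Let H_le p x : `|H p x| <= N.
Proof.
rewrite HE; apply: dominated_le; last by move=> y; exact: normr_cos_le1.
apply: (measurableT_comp measurable_cos); apply: measurable_funM => //.
by apply: measurable_funB => //; exact: measurable_cst.
Qed.

Let measurable_H2 : measurable_fun setT (fun z : R * R => H z.1 z.2).
Proof.
apply: measurable_funD; apply: measurable_funM.
- by apply: (measurableT_comp measurable_fcos).
- by apply: (measurableT_comp measurable_cos); exact: measurable_funM.
- by apply: (measurableT_comp measurable_fsin).
- by apply: (measurableT_comp measurable_sin); exact: measurable_funM.
Qed.

(** Damped inversion: [damp d] supplies the integrability in [p] that Fubini asks for, and the inner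
    integral over [p] is then the cosine transform of [damp d]. *)
Let convE d x : 0 < d ->
  Rint (fun p => damp d p * H p x) = Rint (fun y => phi y * poisson d (x - y)).
Proof.
move=> d0.
transitivity (Rint (fun p => Rint (fun y => damp d p * (phi y * cos (p * (x - y)))))).
  apply: eq_Rintegral => p _; rewrite HE RintegralZl//.
  apply: integrable_mul_bounded => //; last by move=> y; exact: normr_cos_le1.
  apply: (measurableT_comp measurable_cos); apply: measurable_funM => //.
  by apply: measurable_funB => //; exact: measurable_cst.
rewrite (@Rintegral_swap _ _ (damp d) phi)//.
- apply: eq_Rintegral => y _.
  under eq_Rintegral do rewrite mulrCA.
  rewrite RintegralZl// ?Rintegral_damp_cos//.
  apply: integrable_mul_bounded; first exact: integrable_damp.
    by apply: (measurableT_comp measurable_cos); exact: measurable_funM.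
  by move=> p; exact: normr_cos_le1.
- apply: measurable_funM; first by apply: (measurableT_comp (measurable_damp d)).
  apply: measurable_funM; first exact: measurableT_comp.
  apply: (measurableT_comp measurable_cos); apply: measurable_funM => //.
  by apply: measurable_funB => //; exact: measurable_cst.
- exact: integrable_damp.
- by move=> p y; rewrite normrM ler_wpM2l// normrM ler_piMr// normr_cos_le1.
Qed.

Definition poisson_form d := Rint (fun x => phi x * Rint (fun y => phi y * poisson d (x - y))).

Lemma measurable_poisson_conv d : 0 < d ->
  measurable_fun setT (fun x => Rint (fun y => phi y * poisson d (x - y))).
Proof.
move=> d0; apply: (@measurable_Rintegral _ (fun x y => phi y * poisson d (x - y))).
apply: measurable_funM; first exact: measurableT_comp.
by apply: (measurableT_comp (measurable_poisson d0)); exact: measurable_funB.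
Qed.

Let conv_le d x : 0 < d ->
  `|Rint (fun y => phi y * poisson d (x - y))| <= 2 / d * N.
Proof.
move=> d0; rewrite -convE//.
have iN : mu.-integrable setT (EFin \o (fun p => damp d p * N)).
  have := integrableZr measurableT N (integrable_damp d0); exact.
have mH : measurable_fun setT (fun p => damp d p * H p x).
  apply: measurable_funM; first exact: measurable_damp.
  exact: (measurableT_comp measurable_H2 (pair2_measurable x)).
have iH : mu.-integrable setT (EFin \o (fun p => damp d p * H p x)).
  apply: le_integrable iN => //; first exact/measurable_EFinP.
  by move=> p _; rewrite /= lee_fin !normrM ler_wpM2l// (ger0_norm N_ge0).
rewrite (le_trans (le_normr_Rintegral _ iH))//.
rewrite [leRHS](_ : _ = Rint (fun p => damp d p * N)); last first.
  rewrite RintegralZr//; last exact: integrable_damp.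
  by rewrite /Rintegral integral_damp.
apply: le_Rintegral => //; first exact: (integrable_norm iH).
by move=> p _; rewrite normrM (ger0_norm (damp_ge0 _ _)) ler_wpM2l// damp_ge0.
Qed.

Lemma integrable_mul_poisson_conv d : 0 < d -> mu.-integrable setT
  (EFin \o (fun x => phi x * Rint (fun y => phi y * poisson d (x - y)))).
Proof.
move=> d0; have iN := integrableZr measurableT (2 / d * N) iphi.
apply: le_integrable iN => //.
  apply/measurable_EFinP; apply: measurable_funM => //.
  exact: measurable_poisson_conv.
move=> x _; rewrite /= lee_fin !normrM ler_wpM2l//.
by rewrite -!normrM (le_trans (conv_le x d0))// ler_norm.
Qed.

(** For fixed [p] the squared modulus of the transform is the integral of [phi x * H p x] over [x].
    Exchanging this with the damped integral over [p] leaves the Poisson convolution of [convE]. *)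
Lemma damped_energy d : 0 < d ->
  (\int[mu]_p (damp d p * (fcos p ^+ 2 + fsin p ^+ 2))%:E = (poisson_form d)%:E)%E.
Proof.
move=> d0.
have iE : mu.-integrable setT (EFin \o (fun p => damp d p * (fcos p ^+ 2 + fsin p ^+ 2))).
  have := integrableZr measurableT (N ^+ 2 + N ^+ 2) (integrable_damp d0).
  apply: le_integrable => //.
    apply/measurable_EFinP; apply: measurable_funM; first exact: measurable_damp.
    by apply: measurable_funD; apply: measurable_funX;
      [exact: measurable_fcos|exact: measurable_fsin].
  move=> p _; rewrite /= lee_fin !normrM ler_wpM2l//.
  rewrite !ger0_norm ?addr_ge0 ?sqr_ge0//.
  by rewrite lerD// -[leLHS]real_normK ?num_real// lerXn2r// nnegrE.
rewrite -EFin_Rintegral//; congr EFin.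
transitivity (Rint (fun p => Rint (fun x => phi x * (damp d p * H p x)))).
  apply: eq_Rintegral => p _.
  transitivity (damp d p * (fcos p * fcos p + fsin p * fsin p)); first by ring.
  rewrite {2}/fcos {2}/fsin -!RintegralZl// -RintegralD//; last 2 first.
  - by have := integrableZl measurableT (fcos p) (icos p); exact.
  - by have := integrableZl measurableT (fsin p) (isin p); exact.
  rewrite -RintegralZl//; last first.
    have := integrableD measurableT (integrableZl measurableT (fcos p) (icos p))
      (integrableZl measurableT (fsin p) (isin p)); exact.
  by apply: eq_Rintegral => x _; rewrite /H; ring.
rewrite (@Rintegral_swap _ _ (fun p => damp d p * N) phi)//.
- apply: eq_Rintegral => x _; rewrite -convE// RintegralZl//.
  have := integrableZr measurableT N (integrable_damp d0).
  apply: le_integrable => //.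
    apply/measurable_EFinP; apply: measurable_funM; first exact: measurable_damp.
    exact: (measurableT_comp measurable_H2 (pair2_measurable x)).
  by move=> p _; rewrite /= lee_fin !normrM ler_wpM2l// (ger0_norm N_ge0).
- apply: measurable_funM; first exact: measurableT_comp.
  apply: measurable_funM; first by apply: (measurableT_comp (measurable_damp d)).
  exact: measurable_H2.
- by have := integrableZr measurableT N (integrable_damp d0); exact.
- by move=> p x; rewrite normrM mulrC ler_wpM2r// !normrM ler_wpM2l// (ger0_norm N_ge0).
Qed.

End damped_fourier.

(** * Energy of the Fourier transform *)

Section translation.
Context {R : realType}.
Local Notation mu := (@lebesgue_measure R).

(** The map [(x, z) |-> g x - g (x - z)] is continuous and vanishes at [z = 0]; compactness of the
    segment makes the neighbourhood of [z = 0] uniform in [x]. The point [x - z] may leave the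
    segment. *)
Lemma continuous_near_translation (g : R -> R) (a b e : R) : continuous g -> 0 < e ->
  exists2 r, 0 < r & forall z x, `|z| < r -> x \in `[a, b] -> `|g x - g (x - z)| <= e.
Proof.
move=> cg e0.
have /compact_near_coveringP/(_ R (nbhs (0 : R))
  (fun z x => `|g x - g (x - z)| <= e)) := @segment_compact R a b.
move=> /(_ _)[|r /= r0 rP].
  move=> x _.
  pose h (q : R * R) := g q.1 - g (q.1 - q.2).
  have ch : h q @[q --> (x, 0)] --> h (x, 0).
    apply: cvgB; first by apply: (cvg_comp _ _ cvg_fst); exact: cg.
    apply: (cvg_comp (fun q : R * R => q.1 - q.2)); last exact: cg.
    by apply: cvgB; [exact: cvg_fst|exact: cvg_snd].
  move/cvgrPdist_le : ch => /(_ _ e0); rewrite /h/= subr0 subrr.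
  by apply: filterS => q /=; rewrite sub0r normrN.
exists r => // z x zr xab.
by apply: (rP z) => //=; rewrite sub0r normrN.
Qed.

Lemma translation_L1_cvg (phi : R -> R) (T e : R) : 0 < T ->
  mu.-integrable setT (EFin \o phi) -> (forall x, T < `|x| -> phi x = 0) -> 0 < e ->
  exists2 r, 0 < r & forall z, `|z| < r ->
    (\int[mu]_x `|phi x - phi (x - z)|%:E <= e%:E)%E.
Proof.
move=> T0 iphi supp e0.
have /integrableP[/measurable_EFinP mphi _] := iphi.
(* For [|z| < 1]: if [x] lies outside [E1], both [phi x] and [phi (x - z)] vanish; if [x] lies in
   [E1], both [x] and [x - z] lie in [E], where [phi] is approximated by a continuous [g]. *)
pose E : set R := `[- (T + 2), T + 2]%classic.
pose E1 : set R := `[- (T + 1), T + 1]%classic.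
have mE : measurable E by exact: measurable_itv.
have mE1 : measurable E1 by exact: measurable_itv.
have Efin : (mu E < +oo)%E.
  by rewrite /E lebesgue_measure_itv/= lte_fin; case: ifP => // _; rewrite -EFinD ltry.
have iE : mu.-integrable E (EFin \o phi) by exact: integrableS iphi.
have [g_ [cg_ ig_ g_cvg]] := approximation_continuous_integrable mE Efin iE.
have [g cg gE] : exists2 g : R -> R, continuous g &
    (\int[mu]_(z in E) `|(phi z - g z)%:E| < (e / 4)%:E)%E.
  have e40 : (0 < (e / 4)%:E :> \bar R)%E by rewrite lte_fin divr_gt0.
  have [n _ nP] := g_cvg _ (open_ereal_lt' e40).
  by exists (g_ n) => //; exact: (nP n (leqnn n)).
(* Over [E1], of length [2 * (T + 1)], this oscillation of [g] integrates to [e / 2]; the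
   approximation error, counted at [x] and at [x - z], gives the other [e / 4 + e / 4]. *)
pose zeta := e / 4 / (T + 1).
have T1 : 0 < T + 1 by rewrite addr_gt0.
have zeta0 : 0 < zeta by rewrite !divr_gt0.
have [r r0 gr] := @continuous_near_translation g (- (T + 1)) (T + 1) _ cg zeta0.
(* Extending the error by [0] to the whole line makes its integral invariant under translation. *)
pose psi : R -> \bar R := (fun z => `|(phi z - g z)%:E|%E) \_ E.
have mpsi : measurable_fun setT psi.
  apply/(measurable_restrictT _ mE); apply: measurable_funTS.
  apply: measurableT_comp => //; apply/measurable_EFinP; apply: measurable_funB => //.
  exact: continuous_measurable_fun.
have psi0 x : (0 <= psi x)%E by rewrite /psi patchE; case: ifP.
have ipsi : (\int[mu]_x psi x <= (e / 4)%:E)%E.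
  by rewrite -integral_mkcond; exact: ltW.
exists (Num.min r 1); first by rewrite lt_min r0 ltr01.
move=> z; rewrite lt_min => /andP[zr z1].
have msub : measurable_fun setT (fun x : R => x - z).
  by apply: measurable_funB => //; exact: measurable_cst.
have mind : measurable_fun setT (fun x => (zeta%:E * (\1_E1 x)%:E)%E).
  by apply: measurable_funeM; apply/measurable_EFinP; exact: measurable_indic.
have mpsiz : measurable_fun setT (fun x : R => psi (x - z)).
  exact: (measurableT_comp mpsi msub).
apply: (@le_trans _ _ (\int[mu]_x (psi x + psi (x - z)%R + zeta%:E * (\1_E1 x)%:E))%E).
  apply: ge0_le_integral => //.
  - apply/measurable_EFinP; apply: measurableT_comp => //.
    by apply: measurable_funB => //; exact: measurableT_comp.
  - by apply: emeasurable_funD => //; exact: emeasurable_funD.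
  move=> x _; have [xE1|xE1] := boolP (x \in E1); last first.
    have xT : T + 1 < `|x|.
      by move: xE1; rewrite notin_setE /E1/= in_itv/= -ler_norml => /negP; rewrite -ltNge.
    have -> : phi x = 0 by apply: supp; lra.
    have -> : phi (x - z) = 0.
      by apply: supp; have := lerB_dist x z; lra.
    by rewrite subrr normr0 !adde_ge0// mule_ge0// lee_fin ?ltW.
  have xin : x \in `[- (T + 1), T + 1] by move: xE1; rewrite inE.
  have := gr _ _ zr xin.
  have xE : x \in E.
    by rewrite inE /E/= in_itv/=; move: xin; rewrite in_itv/= => /andP[? ?]; apply/andP; split; lra.
  have xzE : x - z \in E.
    rewrite inE /E/= in_itv/=; move: xin; rewrite in_itv/= => /andP[? ?].
    by move: z1; rewrite ltr_norml => /andP[? ?]; apply/andP; split; lra.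
  rewrite /psi !patchE xE xzE indicE xE1 mule1 -!EFinD lee_fin => gx.
  have -> : phi x - phi (x - z) =
    (phi x - g x) - (phi (x - z) - g (x - z)) + (g x - g (x - z)) by ring.
  by rewrite (le_trans (ler_normD _ _))// lerD// ler_normB.
rewrite ge0_integralD//; last 3 first.
- by move=> x _; rewrite adde_ge0.
- exact: emeasurable_funD.
- by move=> x _; rewrite mule_ge0// lee_fin// ltW.
rewrite ge0_integralD// ge0_integral_translation// ge0_integralZl_EFin//; last 2 first.
- by apply/measurable_EFinP; exact: measurable_indic.
- exact: ltW.
have muE1 : mu E1 = (2 * (T + 1))%:E.
  rewrite /E1 lebesgue_measure_itv/= lte_fin ifT; last by lra.
  by rewrite -EFinB; congr EFin; ring.
have -> : (\int[mu]_x (\1_E1 x)%:E = (2 * (T + 1))%:E)%E.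
  by rewrite integral_indic// setIT; exact: muE1.
rewrite -EFinM (_ : zeta * _ = e / 2); last first.
  by rewrite /zeta; field; rewrite gt_eqF.
rewrite [leRHS](_ : _ = ((e / 4)%:E + (e / 4)%:E + (e / 2)%:E)%E); last first.
  by rewrite -!EFinD; congr EFin; field.
by rewrite !leeD.
Qed.

End translation.

(** * Upper and lower bounds for the energy *)

Section energy_bounds.
Context {R : realType}.
Local Notation mu := (@lebesgue_measure R).
Local Notation Rint := (Rintegral mu setT).
Variable phi : R -> R.
Hypothesis iphi : mu.-integrable setT (EFin \o phi).

Let mphi : measurable_fun setT phi.
Proof. by apply/measurable_EFinP; case/integrableP: iphi. Qed.

Implicit Types d x y p : R.

Let E (p : R) := fcos phi p ^+ 2 + fsin phi p ^+ 2.

Let E_ge0 p : 0 <= E p. Proof. by rewrite addr_ge0 ?sqr_ge0. Qed.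

Let measurable_E : measurable_fun setT E.
Proof.
by apply: measurable_funD; apply: measurable_funX;
  [exact: measurable_fcos|exact: measurable_fsin].
Qed.

(** Along [d = 1 / (n + 1)] the damping factors increase to [1], so monotone convergence applies
    even before the energy is known to be finite. *)
Let energy_le (c : \bar R) : (forall d, 0 < d -> ((poisson_form phi d)%:E <= c)%E) ->
  (\int[mu]_p (E p)%:E <= c)%E.
Proof.
move=> hc; pose d n : R := n.+1%:R^-1.
have d0 n : 0 < d n by rewrite invr_gt0.
pose h n p := (damp (d n) p * E p)%:E.
have mh n : measurable_fun setT (h n).
  by apply/measurable_EFinP; apply: measurable_funM => //; exact: measurable_damp.
have h0 n p : setT p -> (0 <= h n p)%E.
  by move=> _; rewrite lee_fin mulr_ge0 ?damp_ge0.
have ndh p : setT p -> {homo h ^~ p : n m / (n <= m)%N >-> (n <= m)%E}.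
  move=> _ n m nm; rewrite lee_fin ler_wpM2r// ler_expR lerN2 ler_wpM2r//.
  by rewrite lef_pV2 ?posrE// ler_nat ltnS.
have hE p : h n p @[n --> \oo] --> (E p)%:E.
  apply: cvg_EFin; first exact: nearW.
  rewrite /comp/= -[X in _ --> X]mul1r; apply: cvgM; last exact: cvg_cst.
  rewrite -(expR0 R); apply: (cvg_comp (fun n => - (d n * `|p|)));
    last exact: continuous_expR.
  rewrite -oppr0 -(mul0r `|p|); apply: cvgN; apply: cvgM; last exact: cvg_cst.
  exact: cvg_harmonic.
have cv : (\int[mu]_p h n p)%E @[n --> \oo] --> (\int[mu]_p (E p)%:E)%E.
  have -> : (\int[mu]_p (E p)%:E = \int[mu]_p limn (h ^~ p))%E.
    by apply: eq_integral => p _; apply/esym/cvg_lim => //; exact: hE.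
  exact: cvg_monotone_convergence.
rewrite -(cvg_lim _ cv)//; apply: lime_le; first by apply/cvg_ex; eexists; exact: cv.
by apply: nearW => n; rewrite damped_energy//; exact: hc.
Qed.

Let le_energy d : 0 < d -> ((poisson_form phi d)%:E <= \int[mu]_p (E p)%:E)%E.
Proof.
move=> d0; rewrite -damped_energy//; apply: ge0_le_integral => //.
- by move=> p _; rewrite lee_fin mulr_ge0 ?damp_ge0//; exact: E_ge0.
- by apply/measurable_EFinP; apply: measurable_funM => //; exact: measurable_damp.
- exact/measurable_EFinP.
- by move=> p _; rewrite lee_fin ler_piMl ?E_ge0// damp_le1// ltW.
Qed.

Let integral_poissonB d x : 0 < d -> (\int[mu]_y (poisson d (x - y))%:E = (2 * pi)%:E)%E.
Proof.
move=> d0; rewrite (@ge0_integral_reflection _ x (fun y => (poisson d y)%:E)).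
- exact: integral_poisson.
- by apply/measurable_EFinP; exact: measurable_poisson.
- by move=> y; rewrite lee_fin poisson_ge0// ltW.
Qed.

Let integral_poissonB' d y : 0 < d -> (\int[mu]_x (poisson d (x - y))%:E = (2 * pi)%:E)%E.
Proof.
move=> d0; rewrite (@ge0_integral_translation _ y (fun y => (poisson d y)%:E)).
- exact: integral_poisson.
- by apply/measurable_EFinP; exact: measurable_poisson.
- by move=> x; rewrite lee_fin poisson_ge0// ltW.
Qed.

Let mpB (d x : R) : 0 < d -> measurable_fun setT (fun y : R => poisson d (x - y)).
Proof.
move=> d0; apply: (measurableT_comp (measurable_poisson d0)).
by apply: measurable_funB => //; exact: measurable_cst.
Qed.

Let mpB' (d y : R) : 0 < d -> measurable_fun setT (fun x : R => poisson d (x - y)).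
Proof.
move=> d0; apply: (measurableT_comp (measurable_poisson d0)).
by apply: measurable_funB => //; exact: measurable_cst.
Qed.

Let mpB2 d : 0 < d -> measurable_fun setT (fun z : R * R => poisson d (z.1 - z.2)).
Proof.
by move=> d0; apply: (measurableT_comp (measurable_poisson d0)); exact: measurable_funB.
Qed.

(* Schur test: the kernel is nonnegative with all its row and column integrals
   equal to [2 * pi]. *)
Lemma energy_upper :
  (\int[mu]_p (fcos phi p ^+ 2 + fsin phi p ^+ 2)%:E <= (2 * pi)%:E * sqint phi)%E.
Proof.
apply: energy_le => d d0.
have k0 x y : 0 <= poisson d (x - y) by rewrite poisson_ge0// ltW.
have mk := mpB2 d0.
(* By AM-GM, [|phi x * phi y|] is at most half the sum of the squares. [F] and [G] carry the two
   halves, and each integrates over the plane to [pi * sqint phi]. *)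
pose F (z : R * R) := (phi z.1 ^+ 2 / 2 * poisson d (z.1 - z.2))%:E.
pose G (z : R * R) := (phi z.2 ^+ 2 / 2 * poisson d (z.1 - z.2))%:E.
have mF : measurable_fun setT F.
  apply/measurable_EFinP; apply: measurable_funM => //; apply: measurable_funM => //.
  by apply: measurable_funX; exact: measurableT_comp.
have mG : measurable_fun setT G.
  apply/measurable_EFinP; apply: measurable_funM => //; apply: measurable_funM => //.
  by apply: measurable_funX; exact: measurableT_comp.
have F0 z : (0 <= F z)%E by rewrite lee_fin mulr_ge0// mulr_ge0// sqr_ge0.
have G0 z : (0 <= G z)%E by rewrite lee_fin mulr_ge0// mulr_ge0// sqr_ge0.
have half (c : R) (k : R -> R) : 0 <= c -> measurable_fun setT k -> (forall x, 0 <= k x) ->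
    (\int[mu]_x (k x)%:E = (2 * pi)%:E ->
     \int[mu]_x (c / 2 * k x)%:E = pi%:E * c%:E)%E.
  move=> c0 mk' k0' kE; under eq_integral do rewrite EFinM.
  rewrite ge0_integralZl_EFin ?divr_ge0//; last 2 first.
  - by move=> ? _; rewrite lee_fin.
  - exact/measurable_EFinP.
  by rewrite kE -!EFinM; congr EFin; field.
have iF x : (\int[mu]_y F (x, y) = pi%:E * (phi x ^+ 2)%:E)%E.
  by rewrite /F/=; apply: (half (phi x ^+ 2) (fun y => poisson d (x - y)));
    [exact: sqr_ge0|exact: mpB|move=> y; exact: k0|exact: integral_poissonB].
have iG y : (\int[mu]_x G (x, y) = pi%:E * (phi y ^+ 2)%:E)%E.
  by rewrite /G/=; apply: (half (phi y ^+ 2) (fun x => poisson d (x - y)));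
    [exact: sqr_ge0|exact: mpB'|move=> x; exact: k0|exact: integral_poissonB'].
apply: (@le_trans _ _ (\int[mu]_x \int[mu]_y (F (x, y) + G (x, y))))%E; last first.
  have mF1 x : measurable_fun setT (fun y => F (x, y)).
    exact: (measurableT_comp mF (pair1_measurable x)).
  have mG1 x : measurable_fun setT (fun y => G (x, y)).
    exact: (measurableT_comp mG (pair1_measurable x)).
  under eq_integral => x _ do rewrite (ge0_integralD mu measurableT
    (fun y _ => F0 (x, y)) (mF1 x) (fun y _ => G0 (x, y)) (mG1 x)).
  have I0 x : setT x -> (0 <= \int[mu]_y F (x, y))%E by move=> _; exact: integral_ge0.
  have J0 x : setT x -> (0 <= \int[mu]_y G (x, y))%E by move=> _; exact: integral_ge0.
  have mI := @measurable_fun_fubini_tonelli_F _ _ _ _ R mu F mF F0.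
  have mJ := @measurable_fun_fubini_tonelli_F _ _ _ _ R mu G mG G0.
  rewrite (ge0_integralD mu measurableT I0 mI J0 mJ).
  (* In [G] the square depends on the inner variable, so its order of integration is exchanged
     before the column integral of the kernel is used. *)
  rewrite [X in (_ + X)%E]fubini_tonelli//.
  under eq_integral do rewrite iF.
  under [X in (_ + X)%E]eq_integral do rewrite iG.
  rewrite ge0_integralZl_EFin ?pi_ge0//; last 2 first.
  - by move=> ? _; rewrite lee_fin sqr_ge0.
  - exact: measurable_sqr.
  rewrite -/(sqint phi) -ge0_muleDl ?lee_fin ?pi_ge0//.
  by rewrite -EFinD -mulr2n mulr_natl.
apply: (@le_trans _ _ (`|poisson_form phi d|%:E)); first by rewrite lee_fin ler_norm.
have mc := measurable_poisson_conv iphi d0.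
apply: le_trans (normr_Rintegral_le (measurable_funM mphi mc)) _.
apply: ge0_le_integral => //.
- by apply/measurable_EFinP; apply: measurableT_comp => //; exact: measurable_funM.
- apply: (@measurable_fun_fubini_tonelli_F _ _ _ _ R mu (fun z => F z + G z)%E).
    exact: emeasurable_funD.
  by move=> z; rewrite adde_ge0.
move=> x _; rewrite normrM EFinM.
have mky : measurable_fun setT (fun y : R => phi y * poisson d (x - y)).
  by apply: measurable_funM => //; exact: mpB.
apply: le_trans (lee_wpmul2l _ (normr_Rintegral_le mky)) _; first by rewrite lee_fin.
rewrite -ge0_integralZl_EFin//; last first.
  by apply/measurable_EFinP; exact: measurableT_comp.
apply: ge0_le_integral => //.
- by apply: measurable_funeM; apply/measurable_EFinP; exact: measurableT_comp.
- apply: emeasurable_funD.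
    exact: (measurableT_comp mF (pair1_measurable x)).
  exact: (measurableT_comp mG (pair1_measurable x)).
move=> y _; rewrite -EFinM -EFinD lee_fin/= normrM (ger0_norm (k0 _ _)) mulrA.
rewrite -mulrDl ler_wpM2r// -subr_ge0 -(real_normK (num_real (phi x))).
rewrite -(real_normK (num_real (phi y))).
rewrite [leRHS](_ : _ = (`|phi x| - `|phi y|) ^+ 2 / 2); last by field.
by rewrite divr_ge0// sqr_ge0.
Qed.

(* With the row integrals equal to [2 * pi], the defect
   [2 * pi * sqint phi - poisson_form phi d] is at most
   [B] times the integral of [poisson d z * ||phi - phi (. - z)||_1] over [z],
   and translations are continuous in [L^1]. *)
Lemma energy_lower (B T : R) : 0 < T -> (forall x, `|phi x| <= B) ->
  (forall x, T < `|x| -> phi x = 0) ->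
  ((2 * pi)%:E * sqint phi <=
   \int[mu]_p (fcos phi p ^+ 2 + fsin phi p ^+ 2)%:E)%E.
Proof.
move=> T0 phiB supp.
have B0 : 0 <= B by rewrite (le_trans _ (phiB 0)).
(* A strictly positive bound, since [e1] divides by it. *)
pose B1 := B + 1; have B10 : 0 < B1 by rewrite ltr_wpDl.
have phiB1 x : `|phi x| <= B1 by rewrite (le_trans (phiB x))// lerDl.
have pi0 : 0 < pi :> R by exact: pi_gt0.
have iphi2 : mu.-integrable setT (EFin \o (fun x => phi x ^+ 2)).
  apply: le_integrable (integrableZl measurableT B1 iphi) => //.
    by apply/measurable_EFinP; exact: measurable_funX.
  move=> x _; rewrite /= lee_fin expr2 !normrM ler_wpM2r//.
  by rewrite (ger0_norm (ltW B10)).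
pose N1 := Rint (fun x => `|phi x|).
have N10 : 0 <= N1 by exact: Rintegral_ge0.
have mtr z : measurable_fun setT (fun x : R => phi (x - z)).
  by apply: (measurableT_comp mphi); apply: measurable_funB => //; exact: measurable_cst.
have D1le z : (\int[mu]_x `|phi x - phi (x - z)|%:E <= (2 * N1)%:E)%E.
  apply: (@le_trans _ _ (\int[mu]_x (`|phi x|%:E + `|phi (x - z)|%:E))%E).
    apply: ge0_le_integral => //.
    - by apply/measurable_EFinP; apply: measurableT_comp => //; exact: (measurable_funB mphi (mtr z)).
    - by apply: emeasurable_funD; apply/measurable_EFinP; apply: measurableT_comp => //; exact: mtr.
    - by move=> x _; rewrite -EFinD lee_fin ler_normB.
  have mn : measurable_fun setT (fun x : R => `|phi x|%:E).
    by apply/measurable_EFinP; exact: measurableT_comp.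
  rewrite ge0_integralD//; last by apply/measurable_EFinP; apply: measurableT_comp => //; exact: mtr.
  rewrite (@ge0_integral_translation _ z (fun x => `|phi x|%:E))//.
  rewrite -EFin_Rintegral; last exact: (integrable_norm iphi).
  by rewrite -EFinD lee_fin -/N1 mulr_natl mulr2n.
apply/lee_addgt0Pr => eta eta0.
(* The contribution of [|z| < r] to the defect is at most [B1 * (e1 * (2 * pi))], which is
   [eta / 2]. *)
pose e1 := eta / (2 * (B1 * (2 * pi))).
have e10 : 0 < e1 by rewrite divr_gt0// !mulr_gt0.
have [r r0 rP] := translation_L1_cvg T0 iphi supp e10.
(* The contribution of [|z| >= r] is at most [d * (Q - 1)], hence at most [eta / 2] for the [d]
   chosen below; the final [1] keeps [Q] positive. *)
pose Q := B1 * (2 * N1 * (1 + r ^- 2) * (2 * pi)) + 1.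
have Q1 : 0 < Q.
  rewrite ltr_wpDl// mulr_ge0 ?(ltW B10)// !mulr_ge0 ?(ltW pi0)//.
  by rewrite addr_ge0// invr_ge0 sqr_ge0.
pose d := eta / (2 * Q).
have d0 : 0 < d by rewrite divr_gt0// mulr_gt0.
apply: (@le_trans _ _ ((poisson_form phi d)%:E + eta%:E)%E); last first.
  by rewrite leeD2r// le_energy.
have k0 x y : 0 <= poisson d (x - y) by rewrite poisson_ge0// ltW.
pose F x y := `|phi x - phi y| * poisson d (x - y).
have mF : measurable_fun setT (fun z : R * R => F z.1 z.2).
  apply: measurable_funM; last exact: mpB2.
  by apply: measurableT_comp => //; apply: measurable_funB; exact: measurableT_comp.
have mF1 x : measurable_fun setT (F x).
  exact: (measurableT_comp mF (pair1_measurable x)).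
have mEF : measurable_fun setT (fun z : R * R => (F z.1 z.2)%:E) by exact/measurable_EFinP.
have EF0 (z : R * R) : (0 <= (F z.1 z.2)%:E)%E by rewrite lee_fin mulr_ge0.
have mIF := @measurable_fun_fubini_tonelli_F _ _ _ _ R mu _ mEF EF0.
have ik x : mu.-integrable setT (EFin \o (fun y => poisson d (x - y))).
  apply/integrableP; split; first by apply/measurable_EFinP; exact: mpB.
  under eq_integral => y _ do rewrite /= ger0_norm//.
  by rewrite integral_poissonB// ltry.
have kphi_int x : mu.-integrable setT (EFin \o (fun y => phi y * poisson d (x - y))).
  apply: le_integrable (integrableZl measurableT B1 (ik x)) => //.
    by apply/measurable_EFinP; apply: measurable_funM => //; exact: mpB.
  by move=> y _; rewrite /= lee_fin normrM [leRHS]normrM ler_wpM2r// (ger0_norm (ltW B10)).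
pose G x := Rint (fun y => phi y * poisson d (x - y)).
have mG : measurable_fun setT G by exact: measurable_poisson_conv.
(* The row integral [2 * pi] of the kernel brings [phi x ^+ 2] under the integral sign, where it
   combines with the product [phi x * phi y] into a difference. *)
have GE x : 2 * pi * phi x ^+ 2 - phi x * G x =
    Rint (fun y => phi x * ((phi x - phi y) * poisson d (x - y))).
  have ikx := integrableZl measurableT (phi x) (ik x).
  rewrite RintegralZl//; last first.
    have := integrableB measurableT ikx (kphi_int x).
    by apply: eq_integrable => // y _; rewrite /= -EFinM -EFinB mulrBl.
  under [in RHS]eq_Rintegral do rewrite mulrBl.
  rewrite RintegralB// RintegralZl//.
  rewrite [Rint (fun y => poisson d (x - y))]/Rintegral integral_poissonB//= -/(G x).
  by ring.
have pointwise x : (`|2 * pi * phi x ^+ 2 - phi x * G x|%:E <=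
    B1%:E * \int[mu]_y (F x y)%:E)%E.
  rewrite GE.
  have m' : measurable_fun setT (fun y => phi x * ((phi x - phi y) * poisson d (x - y))).
    apply: measurable_funM => //; apply: measurable_funM; last exact: mpB.
    by apply: measurable_funB => //; exact: measurable_cst.
  apply: le_trans (normr_Rintegral_le m') _.
  rewrite -ge0_integralZl_EFin ?(ltW B10)//; last 2 first.
  - by move=> y _; rewrite lee_fin mulr_ge0.
  - by apply/measurable_EFinP; exact: mF1.
  apply: ge0_le_integral => //.
  - by apply/measurable_EFinP; apply: measurableT_comp.
  - by apply: measurable_funeM; apply/measurable_EFinP; exact: mF1.
  - by move=> y _; rewrite -EFinM lee_fin 2!normrM (ger0_norm (k0 _ _)) ler_wpM2r// mulr_ge0.
have total : (\int[mu]_x \int[mu]_y (F x y)%:E <=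
    (e1 * (2 * pi) + d * (2 * N1 * (1 + r ^- 2) * (2 * pi)))%:E)%E.
  (* In the variable [z = x - y] the kernel no longer depends on [x]; after Tonelli the inner
     integral is the L^1 distance between [phi] and its translate by [z]. *)
  pose H (w : R * R) := (`|phi w.1 - phi (w.1 - w.2)| * poisson d w.2)%:E.
  have mH : measurable_fun setT H.
    apply/measurable_EFinP; apply: measurable_funM; last first.
      exact: (measurableT_comp (measurable_poisson d0)).
    apply: measurableT_comp => //; apply: measurable_funB; first exact: measurableT_comp.
    by apply: (measurableT_comp mphi); exact: measurable_funB.
  have H0 w : (0 <= H w)%E by rewrite lee_fin mulr_ge0// poisson_ge0// ltW.
  rewrite (_ : (\int[mu]_x _)%E = (\int[mu]_x \int[mu]_z H (x, z))%E); last first.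
    apply: eq_integral => x _.
    rewrite -(@ge0_integral_reflection _ x (fun z => H (x, z)))//; last first.
      exact: (measurableT_comp mH (pair1_measurable x)).
    by apply: eq_integral => y _; rewrite /H/= subKr.
  rewrite fubini_tonelli//.
  have i1 : (\int[mu]_z (e1 * poisson d z)%:E = (e1 * (2 * pi))%:E)%E.
    under eq_integral do rewrite EFinM.
    rewrite ge0_integralZl_EFin ?(ltW e10)//; last 2 first.
    - by move=> z _; rewrite lee_fin poisson_ge0// ltW.
    - by apply/measurable_EFinP; exact: measurable_poisson.
    by rewrite integral_poisson.
  pose c := d * (2 * N1 * (1 + r ^- 2)).
  have c0 : 0 <= c.
    apply: mulr_ge0; first exact: ltW.
    by apply: mulr_ge0; [exact: mulr_ge0|rewrite addr_ge0// invr_ge0 sqr_ge0].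
  have i2 : (\int[mu]_z (c * poisson 1 z)%:E = (c * (2 * pi))%:E)%E.
    under eq_integral do rewrite EFinM.
    rewrite ge0_integralZl_EFin//; last 2 first.
    - by move=> z _; rewrite lee_fin poisson_ge0.
    - by apply/measurable_EFinP; exact: measurable_poisson.
    by rewrite integral_poisson.
  rewrite (_ : d * _ = c * (2 * pi)); last by rewrite /c; ring.
  rewrite EFinD -i1 -i2 -ge0_integralD//; last 4 first.
  - by move=> z _; rewrite lee_fin mulr_ge0 ?(ltW e10)// poisson_ge0// ltW.
  - by apply/measurable_EFinP; apply: measurable_funM => //; exact: measurable_poisson.
  - by move=> z _; rewrite lee_fin mulr_ge0// poisson_ge0.
  - by apply/measurable_EFinP; apply: measurable_funM => //; exact: measurable_poisson.
  apply: ge0_le_integral => //.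
  - by move=> z _; exact: integral_ge0.
  - exact: (@measurable_fun_fubini_tonelli_G _ _ _ _ R mu H mH H0).
  - by apply: emeasurable_funD; apply/measurable_EFinP; apply: measurable_funM => //;
      exact: measurable_poisson.
  move=> z _.
  have kz0 : 0 <= poisson d z by rewrite poisson_ge0// ltW.
  have k10 : 0 <= poisson 1 z by exact: poisson_ge0.
  have mD : measurable_fun setT (fun x => `|phi x - phi (x - z)|%:E).
    by apply/measurable_EFinP; apply: measurableT_comp => //; exact: (measurable_funB mphi (mtr z)).
  rewrite (_ : (\int[mu]_x _)%E =
      ((poisson d z)%:E * \int[mu]_x `|phi x - phi (x - z)|%:E)%E); last first.
    rewrite -ge0_integralZl_EFin//.
    by apply: eq_integral => x _; rewrite /H/= mulrC EFinM.
  have [zr|zr] := ltP `|z| r.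
    apply: (@le_trans _ _ ((poisson d z)%:E * e1%:E)%E).
      by rewrite lee_wpmul2l ?lee_fin// rP.
    by rewrite -EFinM -EFinD lee_fin mulrC lerDl mulr_ge0.
  (* Away from [0] the translate is bounded only crudely, and smallness comes from the kernel:
     [poisson d z <= 2 * d / z ^+ 2], while [z ^+ 2 >= r ^+ 2] gives [1 / z ^+ 2 <= (1 + r ^- 2) /
     (1 + z ^+ 2)]. The result is a multiple of [d * poisson 1 z], whose mass is known. *)
  apply: (@le_trans _ _ ((poisson d z)%:E * (2 * N1)%:E)%E).
    by rewrite lee_wpmul2l ?lee_fin.
  rewrite -EFinM -EFinD lee_fin (@le_trans _ _ (c * poisson 1 z))//; last first.
    by rewrite lerDr mulr_ge0// ltW.
  rewrite /c (_ : d * _ * _ = (d * (1 + r ^- 2) * poisson 1 z) * (2 * N1)); last by ring.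
  rewrite ler_wpM2r ?mulr_ge0// /poisson expr1n.
  have z2 : r ^+ 2 <= z ^+ 2.
    by rewrite -(real_normK (num_real z)) lerXn2r// nnegrE// ltW.
  have r20 : 0 < r ^+ 2 by rewrite exprn_gt0.
  have z20 : 0 < z ^+ 2 by exact: lt_le_trans z2.
  have dd0 : 0 <= 2 * d by rewrite mulr_ge0// ltW.
  apply: (@le_trans _ _ (2 * d / z ^+ 2)).
    apply: ler_wpM2l => //; rewrite lef_pV2 ?posrE//; last by rewrite ltr_wpDl ?sqr_ge0.
    by rewrite lerDr sqr_ge0.
  have h1 : 0 < 1 + z ^+ 2 by rewrite addr_gt0.
  rewrite [leRHS](_ : _ = 2 * d * ((1 + r ^- 2) / (1 + z ^+ 2))); last first.
    by field; rewrite !gt_eqF.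
  apply: ler_wpM2l => //; rewrite ler_pdivlMr// mulrDr mulr1 mulVf ?gt_eqF//.
  by rewrite addrC lerD2l lef_pV2.
have iG := integrable_mul_poisson_conv iphi d0.
have i2phi := integrableZl measurableT (2 * pi) iphi2.
have mdiff : measurable_fun setT (fun x => 2 * pi * phi x ^+ 2 - phi x * G x).
  by apply: measurable_funB; apply: measurable_funM => //; exact: measurable_funX.
have key : ((2 * pi * Rint (fun x => (phi x ^+ 2)) - poisson_form phi d)%:E <= eta%:E)%E.
  rewrite -RintegralZl// -RintegralB//.
  apply: (@le_trans _ _ `|Rint (fun x => 2 * pi * phi x ^+ 2 - phi x * G x)|%:E).
    by rewrite lee_fin ler_norm.
  apply: le_trans (normr_Rintegral_le mdiff) _.
  apply: (@le_trans _ _ (\int[mu]_x (B1%:E * \int[mu]_y (F x y)%:E))%E).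
    apply: ge0_le_integral => //.
    - by apply/measurable_EFinP; exact: measurableT_comp.
    - exact: measurable_funeM.
  rewrite ge0_integralZl_EFin ?(ltW B10)//; last first.
    by move=> x _; apply: integral_ge0 => y _; rewrite lee_fin mulr_ge0.
  apply: le_trans (lee_wpmul2l _ total) _; first by rewrite lee_fin ltW.
  rewrite -EFinM lee_fin.
  apply: (@le_trans _ _ (eta / 2 + d * Q)); last first.
    by rewrite (_ : eta / 2 + d * Q = eta)// /d; field; rewrite gt_eqF.
  rewrite mulrDr lerD//.
    have e1E (b q : R) : 0 < b -> 0 < q ->
        b * (eta / (2 * (b * (2 * q))) * (2 * q)) = eta / 2.
      by move=> b0 q0; field; rewrite !gt_eqF.
    by rewrite e1E.
  by rewrite mulrCA ler_wpM2l ?(ltW d0)// /Q lerDl.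
have -> : sqint phi = (Rint (fun x => phi x ^+ 2))%:E by rewrite EFin_Rintegral.
by rewrite -EFinM -EFinD lee_fin -lerBlDl -lee_fin.
Qed.

End energy_bounds.

(** * Plancherel theorem *)

Section plancherel.
Context {R : realType}.
Local Notation mu := (@lebesgue_measure R).
Local Notation Rint := (Rintegral mu setT).
Implicit Types (f g w : R -> R) (p x t T : R).

Let c0 : R := (Num.sqrt (2 * pi))^-1.

Definition ftre f p := c0 * fcos f p.
Definition ftim f p := - (c0 * fsin f p).

Let twopi_gt0 : 0 < 2 * pi :> R. Proof. by rewrite mulr_gt0// pi_gt0. Qed.

Let c0_sqr : c0 ^+ 2 * (2 * pi) = 1.
Proof. by rewrite /c0 exprVn sqr_sqrtr ?(ltW twopi_gt0)// mulVf// gt_eqF. Qed.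

Lemma integrable_measurable f : mu.-integrable setT (EFin \o f) -> measurable_fun setT f.
Proof. by case/integrableP => /measurable_EFinP. Qed.

Lemma measurable_ftre f : mu.-integrable setT (EFin \o f) -> measurable_fun setT (ftre f).
Proof. by move=> fi; apply: measurable_funM => //; exact: measurable_fcos. Qed.

Lemma measurable_ftim f : mu.-integrable setT (EFin \o f) -> measurable_fun setT (ftim f).
Proof.
move=> fi; apply: measurable_funN; apply: measurable_funM => //.
exact: measurable_fsin.
Qed.

Lemma sqint_ft f : mu.-integrable setT (EFin \o f) ->
  (sqint (ftre f) + sqint (ftim f) =
    (c0 ^+ 2)%:E * \int[mu]_p (fcos f p ^+ 2 + fsin f p ^+ 2)%:E)%E.
Proof.
move=> fi; have mc := measurable_fcos fi; have ms := measurable_fsin fi.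
rewrite sqintN !sqintZ// -ge0_muleDr ?sqint_ge0//; congr (_ * _)%E.
rewrite -ge0_integralD//.
- by move=> p _; rewrite lee_fin sqr_ge0.
- exact: measurable_sqr.
- by move=> p _; rewrite lee_fin sqr_ge0.
- exact: measurable_sqr.
Qed.

Lemma sqint_ft_le f : mu.-integrable setT (EFin \o f) ->
  (sqint (ftre f) + sqint (ftim f) <= sqint f)%E.
Proof.
move=> fi; rewrite sqint_ft//.
apply: le_trans (lee_wpmul2l _ (energy_upper fi)) _; first by rewrite lee_fin sqr_ge0.
by rewrite muleA -EFinM c0_sqr mul1e.
Qed.

Lemma sqint_ft_ge f (B T : R) : mu.-integrable setT (EFin \o f) -> 0 < T ->
  (forall x, `|f x| <= B) -> (forall x, T < `|x| -> f x = 0) ->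
  (sqint f <= sqint (ftre f) + sqint (ftim f))%E.
Proof.
move=> fi T0 fB supp; rewrite sqint_ft//.
rewrite -[leLHS]mul1e -c0_sqr EFinM -muleA lee_wpmul2l ?lee_fin ?sqr_ge0//.
exact: energy_lower fB supp.
Qed.

Lemma inL2_ft f : mu.-integrable setT (EFin \o f) -> inL2 f ->
  inL2 (ftre f) /\ inL2 (ftim f).
Proof.
move=> fi /inL2P[mf fy]; have h := le_lt_trans (sqint_ft_le fi) fy.
split; apply/inL2P; split; [exact: measurable_ftre| |exact: measurable_ftim|].
- by apply: le_lt_trans h; rewrite leeDl// sqint_ge0.
- by apply: le_lt_trans h; rewrite leeDr// sqint_ge0.
Qed.

Lemma fine_sqint_ft_le f : mu.-integrable setT (EFin \o f) -> inL2 f ->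
  fine (sqint (ftre f)) + fine (sqint (ftim f)) <= fine (sqint f).
Proof.
move=> fi f2; have [/inL2P[_ ry] /inL2P[_ iy]] := inL2_ft fi f2.
move: f2 => /inL2P[mf fy]; rewrite -fineD ?sqint_fin_num//.
by apply: fine_le; rewrite ?fin_num_sqintD ?sqint_fin_num// sqint_ft_le.
Qed.

Lemma fine_sqint_ft_ge f (B T : R) : mu.-integrable setT (EFin \o f) -> inL2 f ->
  0 < T -> (forall x, `|f x| <= B) -> (forall x, T < `|x| -> f x = 0) ->
  fine (sqint f) <= fine (sqint (ftre f)) + fine (sqint (ftim f)).
Proof.
move=> fi f2 T0 fB supp; have [/inL2P[_ ry] /inL2P[_ iy]] := inL2_ft fi f2.
move: f2 => /inL2P[mf fy]; rewrite -fineD ?sqint_fin_num//.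
apply: fine_le; rewrite ?fin_num_sqintD ?sqint_fin_num//.
exact: sqint_ft_ge fB supp.
Qed.

Lemma fcosB f g p : mu.-integrable setT (EFin \o f) -> mu.-integrable setT (EFin \o g) ->
  fcos (fun x => f x - g x) p = fcos f p - fcos g p.
Proof.
move=> fi gi; have mc : measurable_fun setT (fun x => cos (p * x)).
  by apply: (measurableT_comp measurable_cos); exact: measurable_funM.
rewrite /fcos -RintegralB//; first by apply: eq_Rintegral => x _; rewrite mulrBl.
- by apply: integrable_mul_bounded => // x; exact: normr_cos_le1.
- by apply: integrable_mul_bounded => // x; exact: normr_cos_le1.
Qed.

Lemma fsinB f g p : mu.-integrable setT (EFin \o f) -> mu.-integrable setT (EFin \o g) ->
  fsin (fun x => f x - g x) p = fsin f p - fsin g p.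
Proof.
move=> fi gi; have mc : measurable_fun setT (fun x => sin (p * x)).
  by apply: (measurableT_comp measurable_sin); exact: measurable_funM.
rewrite /fsin -RintegralB//; first by apply: eq_Rintegral => x _; rewrite mulrBl.
- by apply: integrable_mul_bounded => // x; exact: normr_sin_le1.
- by apply: integrable_mul_bounded => // x; exact: normr_sin_le1.
Qed.

Definition trunc T f : R -> R := f \_ `[- T, T].

Lemma measurable_trunc T f : measurable_fun setT f -> measurable_fun setT (trunc T f).
Proof.
move=> mf; apply/(measurable_restrictT _ (measurable_itv _)).
exact: measurable_funTS.
Qed.

Lemma trunc_le T f x : `|trunc T f x| <= `|f x|.
Proof. by rewrite /trunc patchE; case: ifP => // _; rewrite normr0. Qed.

Lemma trunc_eq0 T f x : T < `|x| -> trunc T f x = 0.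
Proof.
move=> Tx; rewrite /trunc patchE ifF//; apply/negbTE.
by rewrite notin_setE/= in_itv/= -ler_norml; apply/negP; rewrite -ltNge.
Qed.

(** On the bounded interval [|f|] is at most [1 + f ^+ 2], which is integrable there. *)
Lemma trunc_inL2_integrable T f : inL2 f -> mu.-integrable setT (EFin \o trunc T f).
Proof.
move=> /inL2P[mf fy].
have if2 : mu.-integrable setT (EFin \o (fun x => f x ^+ 2)).
  apply/integrableP; split; first exact: measurable_sqr.
  by under eq_integral => x _ do rewrite /= ger0_norm ?sqr_ge0//.
have i1 : mu.-integrable setT (EFin \o (\1_`[- T, T] : R -> R)).
  exact: integrable_indic_itv.
have := integrableD measurableT i1 if2.
apply: le_integrable => //; first by apply/measurable_EFinP; exact: measurable_trunc.
move=> x _; rewrite /= lee_fin /trunc patchE indicE; case: (x \in _); last by rewrite normr0.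
rewrite [leRHS]ger0_norm ?addr_ge0 ?sqr_ge0// -(real_normK (num_real (f x))).
rewrite (_ : true%:R = 1 :> R)//.
have := normr_ge0 (f x); have := sqr_ge0 (`|f x| - 1); rewrite sqrrB expr1n mulr1.
by move: `|f x| => y; lra.
Qed.

Lemma FT_trunc_reE w T p : FT_trunc_re w T p = ftre (trunc T w) p.
Proof.
rewrite /FT_trunc_re Rintegral_mkcond /ftre /fcos; congr (_ * Rint _).
by apply/funext => x; rewrite /trunc !patchE; case: ifP => // _; rewrite mul0r.
Qed.

Lemma FT_trunc_imE w T p : FT_trunc_im w T p = ftim (trunc T w) p.
Proof.
rewrite /FT_trunc_im Rintegral_mkcond /ftim /fsin; congr (- (_ * Rint _)).
by apply/funext => x; rewrite /trunc !patchE; case: ifP => // _; rewrite mul0r.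
Qed.

Lemma L2norm_cvg0_sqint (F : R -> R -> R) : (L2norm (F T)) @[T --> +oo] --> 0%E ->
  forall e, 0 < e -> \forall T \near +oo, (sqint (F T) <= e%:E)%E.
Proof.
move=> cv e e0.
have se0 : (0 < (Num.sqrt e)%:E :> \bar R)%E by rewrite lte_fin sqrtr_gt0.
near=> T; have /ltW NT : (L2norm (F T) < (Num.sqrt e)%:E)%E.
  by near: T; exact: (cv _ (open_ereal_lt' se0)).
rewrite -L2norm_sqr -[e]sqr_sqrtr ?(ltW e0)// expr2 EFinM.
by apply: lee_pmul => //; exact: L2norm_ge0.
Unshelve. all: by end_near. Qed.

(** The error may be chosen after the weight [t], so the growth of [1 + t^-1] is harmless: [t] is
    fixed first with [t * Y] small, then the error. *)
Lemma le_weighted (X Y : R) : 0 <= Y ->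
  (forall t e, 0 < t -> 0 < e -> X <= (1 + t) * Y + (1 + t^-1) * e) -> X <= Y.
Proof.
move=> Y0 h; apply/ler_addgt0Pr => e e0.
pose t := e / (2 * (Y + 1)); have Y1 : 0 < Y + 1 by rewrite ltr_wpDl.
have t0 : 0 < t by rewrite divr_gt0// mulr_gt0.
have t1 : 0 < 1 + t^-1 by rewrite addr_gt0// invr_gt0.
have d0 : 0 < e / (2 * (1 + t^-1)) by rewrite divr_gt0// mulr_gt0.
apply: le_trans (h _ _ t0 d0) _.
have -> : (1 + t^-1) * (e / (2 * (1 + t^-1))) = e / 2.
  by move: t1; move: (1 + t^-1) => s s0; field; rewrite gt_eqF.
have tY : t * Y <= e / 2.
  have -> : e / 2 = t * (Y + 1) by rewrite /t; field; rewrite gt_eqF.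
  by rewrite ler_wpM2l ?(ltW t0)// lerDl.
by rewrite mulrDl mul1r; lra.
Qed.

(** Large values are replaced by [0] instead of being clipped. A function then differs from its
    cutoff only where the cutoff vanishes, so their squared integrals add up exactly. *)
Definition cutoff n f : R -> R :=
  (fun x => if `|f x| <= n%:R then f x else 0).

Lemma measurable_cutoff n f : measurable_fun setT f -> measurable_fun setT (cutoff n f).
Proof.
move=> mf; apply: measurable_fun_ifT => //.
by apply: measurable_fun_ler => //; exact: measurableT_comp.
Qed.

Lemma cutoff_le n f x : `|cutoff n f x| <= `|f x|.
Proof. by rewrite /cutoff; case: ifP => // _; rewrite normr0. Qed.

Lemma cutoff_leN n f x : `|cutoff n f x| <= n%:R.
Proof. by rewrite /cutoff; case: ifP => // _; rewrite normr0. Qed.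

(** Dominated convergence with dominating function [f ^+ 2]: at each [x] the difference is exactly
    [0] once [n] exceeds [|x|] and [|f x|]. *)
Lemma sqint_trunc_cutoff_cvg0 f : inL2 f -> forall e, 0 < e ->
  \forall n \near \oo, (sqint (fun x => f x - trunc n%:R (cutoff n f) x)%R <= e%:E)%E.
Proof.
move=> /inL2P[mf fy] e e0.
pose h n x := ((f x - trunc n%:R (cutoff n f) x) ^+ 2)%:E.
have mh n : measurable_fun setT (h n).
  apply: measurable_sqr; apply: measurable_funB => //.
  by apply: measurable_trunc; exact: measurable_cutoff.
have if2 : mu.-integrable setT (EFin \o (fun x => f x ^+ 2)).
  apply/integrableP; split; first exact: measurable_sqr.
  by under eq_integral => x _ do rewrite /= ger0_norm ?sqr_ge0//.
have hcvg x : setT x -> h n x @[n --> \oo] --> (cst 0%E : R -> \bar R) x.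
  move=> _; apply: cvg_near_cst.
  near=> n; rewrite /h /trunc /cutoff patchE ifT; last first.
    rewrite inE/= in_itv/= -ler_norml; near: n; exact: nbhs_infty_ger.
  rewrite ifT ?subrr ?expr0n//.
  by near: n; exact: nbhs_infty_ger.
have hle n x : setT x -> (`|h n x| <= (f x ^+ 2)%:E)%E.
  move=> _; rewrite /h /= lee_fin ger0_norm ?sqr_ge0//.
  rewrite /trunc patchE; case: ifP => _; last by rewrite subr0.
  by rewrite /cutoff; case: ifP => _; rewrite ?subrr ?subr0// expr0n/= sqr_ge0.
have cv : (\int[mu]_x h n x)%E @[n --> \oo] --> 0%E.
  rewrite -(@integral0 _ _ _ mu setT).
  exact: (@dominated_cvg _ _ _ mu _ measurableT h (cst 0%E) (fun x => (f x ^+ 2)%:E)).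
have e0' : (0 < e%:E :> \bar R)%E by rewrite lte_fin.
near=> n; apply: ltW; near: n; exact: (cv _ (open_ereal_lt' e0')).
Unshelve. all: by end_near. Qed.

(** For [>=] the transform of [trunc T w] is close to [Wr, Wi] and its energy is at most [sqint w].
    For [<=] the lower energy bound is applied to the bounded [phi], and the transform of the
    discrepancy [chi] between the two truncations is estimated by the upper energy bound. *)
Theorem plancherel w Wr Wi : inL2 w -> is_FT w Wr Wi ->
  sqint w = (sqint Wr + sqint Wi)%E.
Proof.
move=> w2 [Wr2 [Wi2 [/L2norm_cvg0_sqint cr /L2norm_cvg0_sqint ci]]].
have /inL2P[mw wy] := w2; have /inL2P[mWr Wry] := Wr2; have /inL2P[mWi Wiy] := Wi2.
pose X := fine (sqint w); pose Yr := fine (sqint Wr); pose Yi := fine (sqint Wi).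
have XE : sqint w = X%:E by rewrite fineK// sqint_fin_num.
have YrE : sqint Wr = Yr%:E by rewrite fineK// sqint_fin_num.
have YiE : sqint Wi = Yi%:E by rewrite fineK// sqint_fin_num.
have X0 : 0 <= X by rewrite fine_ge0// sqint_ge0.
have Yr0 : 0 <= Yr by rewrite fine_ge0// sqint_ge0.
have Yi0 : 0 <= Yi by rewrite fine_ge0// sqint_ge0.
have iT T : mu.-integrable setT (EFin \o trunc T w) by exact: trunc_inL2_integrable.
have wT2 T : inL2 (trunc T w).
  by apply: inL2_le w2 _; [exact: measurable_trunc|exact: trunc_le].
pose Ar T := FT_trunc_re w T; pose Ai T := FT_trunc_im w T.
have ArE T : Ar T = ftre (trunc T w) by apply/funext => p; exact: FT_trunc_reE.
have AiE T : Ai T = ftim (trunc T w) by apply/funext => p; exact: FT_trunc_imE.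
have [Ar2 Ai2] : (forall T, inL2 (Ar T)) /\ (forall T, inL2 (Ai T)).
  by split=> T; have [] := inL2_ft (iT T) (wT2 T); rewrite -ArE -AiE.
have dr2 T : inL2 (fun p => Ar T p - Wr p) by exact: inL2B.
have di2 T : inL2 (fun p => Ai T p - Wi p) by exact: inL2B.
pose dr T := fine (sqint (fun p => Ar T p - Wr p)).
pose di T := fine (sqint (fun p => Ai T p - Wi p)).
have fine_bound f (e : R) : inL2 f -> (sqint f <= e%:E)%E -> fine (sqint f) <= e.
  by move=> /inL2P[_ fy]; rewrite -{1}[sqint f]fineK ?sqint_fin_num.
rewrite XE YrE YiE -EFinD; congr EFin; apply/eqP; rewrite eq_le; apply/andP; split.
- apply: le_weighted => [|t e t0 e0]; first exact: addr_ge0.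
  have t1 : 0 < t^-1 by rewrite invr_gt0.
  (* Seven shares of the error: [dr] and [di], each doubled by the inequality with weight [1], take
     four; the doubled energy of [chi] takes two; the mass of [w - phi] in [h7] takes one. *)
  have e7 : 0 < e / 7 by rewrite divr_gt0.
  have [T1 [_ hr]] := cr _ e7; have [T2 [_ hi]] := ci _ e7.
  near \oo => n.
  have T1n : T1 < n%:R by near: n; exact: nbhs_infty_gtr.
  have T2n : T2 < n%:R by near: n; exact: nbhs_infty_gtr.
  have n0 : 0 < n%:R :> R by near: n; exact: nbhs_infty_gtr.
  pose phi := trunc n%:R (cutoff n w).
  have kap : (sqint (fun x => w x - phi x)%R <= (e / 7)%:E)%E.
    by rewrite /phi; near: n; exact: sqint_trunc_cutoff_cvg0.
  have mcw : measurable_fun setT (cutoff n w) by exact: measurable_cutoff.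
  have cw2 : inL2 (cutoff n w) by apply: (inL2_le mcw w2) => x; exact: cutoff_le.
  have iphi : mu.-integrable setT (EFin \o phi) by exact: trunc_inL2_integrable.
  have mphi := integrable_measurable iphi.
  have phi2 : inL2 phi by apply: (inL2_le mphi cw2) => x; exact: trunc_le.
  pose chi x := trunc n%:R w x - phi x.
  have ichi : mu.-integrable setT (EFin \o chi).
    by have := integrableB measurableT (iT n%:R) iphi; exact.
  have chi2 : inL2 chi by exact: inL2B.
  have wphi2 : inL2 (fun x => w x - phi x) by exact: inL2B.
  have {kap}kap := fine_bound _ _ wphi2 kap.
  have hdr : dr n%:R <= e / 7 by apply: fine_bound => //; exact: hr.
  have hdi : di n%:R <= e / 7 by apply: fine_bound => //; exact: hi.
  have [rchi2 ichi2] := inL2_ft ichi chi2.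
  have rE : ftre phi = (fun p => Wr p + (Ar n%:R p - Wr p + - ftre chi p)).
    by apply/funext => p; rewrite ArE /ftre fcosB//; ring.
  have iE : ftim phi = (fun p => Wi p + (Ai n%:R p - Wi p + - ftim chi p)).
    by apply/funext => p; rewrite AiE /ftim fsinB//; ring.
  have hphi : fine (sqint phi) <= fine (sqint (ftre phi)) + fine (sqint (ftim phi)).
    apply: (@fine_sqint_ft_ge _ n%:R n%:R) => // x; last exact: trunc_eq0.
    by rewrite (le_trans (trunc_le _ _ _))// cutoff_leN.
  have rr2 := inL2D (dr2 n%:R) (inL2N rchi2).
  have ii2 := inL2D (di2 n%:R) (inL2N ichi2).
  have h1 := fine_sqintD_weighted t0 Wr2 rr2.
  have h2 := fine_sqintD_weighted t0 Wi2 ii2.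
  have h3 := fine_sqintD_weighted ltr01 (dr2 n%:R) (inL2N rchi2).
  have h4 := fine_sqintD_weighted ltr01 (di2 n%:R) (inL2N ichi2).
  rewrite -rE in h1; rewrite -iE in h2.
  rewrite sqintN invr1 -/(dr _) in h3; rewrite sqintN invr1 -/(di _) in h4.
  have h5 := fine_sqint_ft_le ichi chi2.
  have h6 : fine (sqint chi) <= fine (sqint (fun x => w x - phi x)).
    apply: fine_sqint_le => //; first by case: chi2.
    move=> x; rewrite /chi /phi /trunc !patchE; case: ifP => // _.
    by rewrite subrr normr0.
  (* In fact an equality: at every point either [phi] or [w - phi] vanishes. *)
  have h7 : X <= fine (sqint phi) + fine (sqint (fun x => w x - phi x)).
    move: phi2 wphi2 => /inL2P[_ py] /inL2P[mwp wpy].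
    rewrite -fineD ?sqint_fin_num//.
    apply: fine_le; rewrite ?fin_num_sqintD ?sqint_fin_num//.
    rewrite -ge0_integralD//; last 4 first.
    + by move=> x _; rewrite lee_fin sqr_ge0.
    + exact: measurable_sqr.
    + by move=> x _; rewrite lee_fin sqr_ge0.
    + exact: measurable_sqr.
    rewrite /sqint le_eqVlt; apply/orP; left; apply/eqP; apply: eq_integral => x _.
    rewrite -EFinD; congr EFin; rewrite /phi /trunc /cutoff patchE.
    by case: ifP => _; [case: ifP => _|]; rewrite ?subrr ?subr0 expr0n/= ?addr0 ?add0r.
  have s1 : 0 <= t^-1 * (e / 7) by rewrite mulr_ge0// ltW.
  have h8 := fine_sqint_ge0 (ftre phi); have h9 := fine_sqint_ge0 (ftim phi).
  set r2 := fine (sqint (fun p => Ar n%:R p - Wr p + - ftre chi p)) in h1 h3.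
  set i2 := fine (sqint (fun p => Ai n%:R p - Wi p + - ftim chi p)) in h2 h4.
  have h10 : (1 + t^-1) * (r2 + i2) <= (1 + t^-1) * (6 * (e / 7)).
    rewrite ler_wpM2l ?addr_ge0 ?(ltW t1)//.
    by clear -h3 h4 h5 h6 kap hdr hdi; lra.
  rewrite -/Yr in h1; rewrite -/Yi in h2.
  rewrite (_ : (1 + t^-1) * e = (1 + t^-1) * (6 * (e / 7)) + (e / 7 + t^-1 * (e / 7))); last by field; rewrite gt_eqF.
  clear -h1 h2 hphi h7 h10 kap s1; lra.
- apply: le_weighted => // t e t0 e0.
  have t1 : 0 < t^-1 by rewrite invr_gt0.
  have e2 : 0 < e / 2 by rewrite divr_gt0.
  have [T1 [_ hr]] := cr _ e2; have [T2 [_ hi]] := ci _ e2.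
  pose T := Num.max T1 T2 + 1.
  have T1T : T1 < T by rewrite /T ltr_pwDr// le_max lexx.
  have T2T : T2 < T by rewrite /T ltr_pwDr// le_max lexx orbT.
  have hdr : dr T <= e / 2 by apply: fine_bound => //; exact: hr.
  have hdi : di T <= e / 2 by apply: fine_bound => //; exact: hi.
  have WrE : Wr = (fun p => Ar T p + - (Ar T p - Wr p)) by apply/funext => p; ring.
  have WiE : Wi = (fun p => Ai T p + - (Ai T p - Wi p)) by apply/funext => p; ring.
  have h1 := fine_sqintD_weighted t0 (Ar2 T) (inL2N (dr2 T)).
  have h2 := fine_sqintD_weighted t0 (Ai2 T) (inL2N (di2 T)).
  rewrite -WrE sqintN -/(dr _) -/Yr in h1; rewrite -WiE sqintN -/(di _) -/Yi in h2.
  have h3 := fine_sqint_ft_le (iT T) (wT2 T).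
  rewrite -ArE -AiE in h3.
  have h4 : fine (sqint (trunc T w)) <= X.
    by apply: fine_sqint_le => //; [exact: measurable_trunc|exact: trunc_le].
  have h5 : (1 + t) * (fine (sqint (Ar T)) + fine (sqint (Ai T))) <= (1 + t) * X.
    by rewrite ler_wpM2l ?addr_ge0 ?(ltW t0)//; lra.
  have h6 : (1 + t^-1) * (dr T + di T) <= (1 + t^-1) * e.
    by rewrite ler_wpM2l ?addr_ge0 ?(ltW t1)//; lra.
  lra.
Unshelve. all: by end_near. Qed.

End plancherel.

(** * The operator [L] *)

Section logarithmic_operator.
Context {R : realType}.
Local Notation mu := (@lebesgue_measure R).
Implicit Types (a b C p q : R) (w h : R -> R).

Lemma ae_imply2 (P Q S : R -> Prop) : (forall x, P x -> Q x -> S x) ->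
  {ae mu, forall x, P x} -> {ae mu, forall x, Q x} -> {ae mu, forall x, S x}.
Proof. exact: (@filterS2 _ _ (ae_filter_ringOfSetsType mu)). Qed.

Lemma ae_imply (P Q : R -> Prop) : (forall x, P x -> Q x) ->
  {ae mu, forall x, P x} -> {ae mu, forall x, Q x}.
Proof. exact: (@filterS _ _ (ae_filter_ringOfSetsType mu)). Qed.

Lemma L2norm_cvg0B (F G : R -> R -> R) : (forall T, inL2 (F T)) -> (forall T, inL2 (G T)) ->
  L2norm (F T) @[T --> +oo] --> 0%E -> L2norm (G T) @[T --> +oo] --> 0%E ->
  L2norm (fun x => F T x - G T x) @[T --> +oo] --> 0%E.
Proof.
move=> F2 G2 cF cG.
have cFG : (L2norm (F T) + L2norm (G T))%E @[T --> +oo] --> 0%E.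
  by rewrite -(adde0 0%E); apply: cvgeD.
apply: (squeeze_cvge _ (cvg_cst 0%E) cFG); apply: nearW => T /=.
rewrite L2norm_ge0/=.
have [mF _] := F2 T; have [mG _] := G2 T.
have -> : L2norm (G T) = L2norm (fun x => - G T x).
  exact/esym/(@oppe_Lnorm _ _ _ mu (EFin \o G T)).
apply: (@minkowski_EFin _ _ _ mu (F T) (fun x => - G T x)) => //.
- exact: measurable_funN.
- by rewrite ler1n.
Qed.

Lemma inL2_FT_trunc w T : inL2 w -> inL2 (FT_trunc_re w T) /\ inL2 (FT_trunc_im w T).
Proof.
move=> w2; have iT := trunc_inL2_integrable T w2.
have w2T : inL2 (trunc T w).
  apply: (inL2_le _ w2); last exact: trunc_le.
  by apply: measurable_trunc; case: w2.
have -> : FT_trunc_re w T = ftre (trunc T w) by apply/funext => p; exact: FT_trunc_reE.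
have -> : FT_trunc_im w T = ftim (trunc T w) by apply/funext => p; exact: FT_trunc_imE.
exact: inL2_ft.
Qed.

Lemma is_FTB w w' Wr Wi Wr' Wi' : inL2 w -> inL2 w' ->
  is_FT w Wr Wi -> is_FT w' Wr' Wi' ->
  is_FT (fun x => w x - w' x) (fun p => Wr p - Wr' p) (fun p => Wi p - Wi' p).
Proof.
move=> w2 w2' [Wr2 [Wi2 [cr ci]]] [Wr2' [Wi2' [cr' ci']]].
split; first exact: inL2B.
split; first exact: inL2B.
have truncB T : trunc T (fun x => w x - w' x) = (fun x => trunc T w x - trunc T w' x).
  by apply/funext => x; rewrite /trunc !patchE; case: ifP => // _; rewrite subrr.
have iT T := trunc_inL2_integrable T w2; have iT' T := trunc_inL2_integrable T w2'.
split.
- have := L2norm_cvg0B (fun T => inL2B (inL2_FT_trunc T w2).1 Wr2)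
    (fun T => inL2B (inL2_FT_trunc T w2').1 Wr2') cr cr'.
  apply: cvg_trans; apply: near_eq_cvg; apply: nearW => T; congr L2norm.
  by apply/funext => p; rewrite !FT_trunc_reE truncB /ftre fcosB//; ring.
- have := L2norm_cvg0B (fun T => inL2B (inL2_FT_trunc T w2).2 Wi2)
    (fun T => inL2B (inL2_FT_trunc T w2').2 Wi2') ci ci'.
  apply: cvg_trans; apply: near_eq_cvg; apply: nearW => T; congr L2norm.
  by apply/funext => p; rewrite !FT_trunc_imE truncB /ftim fsinB//; ring.
Qed.

Lemma solves_LB a b w h w' h' : solves_L a b w h -> solves_L a b w' h' ->
  solves_L a b (fun x => w x - w' x) (fun x => h x - h' x).
Proof.
move=> [w2 [h2 [Wr [Wi [Hr [Hi [Fw [Fh eq]]]]]]]].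
move=> [w2' [h2' [Wr' [Wi' [Hr' [Hi' [Fw' [Fh' eq']]]]]]]].
split; first exact: inL2B.
split; first exact: inL2B.
exists (fun p => Wr p - Wr' p), (fun p => Wi p - Wi' p),
  (fun p => Hr p - Hr' p), (fun p => Hi p - Hi' p).
split; first exact: is_FTB.
split; first exact: is_FTB.
move: eq eq'; apply: ae_imply2 => p [<- <-] [<- <-]; split; ring.
Qed.

Definition lam_sqr a b p := lam_re a p ^+ 2 + lam_im b p ^+ 2.

Lemma lam_sqr_ge a b C p : 0 < C -> C <= lam_abs a b p -> C ^+ 2 <= lam_sqr a b p.
Proof.
move=> C0 h; rewrite -[leRHS]sqr_sqrtr ?addr_ge0 ?sqr_ge0//.
by rewrite lerXn2r// nnegrE ?sqrtr_ge0// ltW.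
Qed.

Lemma lam_sqrN a b p : lam_sqr a b (- p) = lam_sqr a b p.
Proof. by rewrite /lam_sqr /lam_re /lam_im normrN mulrN opprK sqrrN. Qed.

Lemma lam_reE a p : 0 < p -> lam_re a p = ln p - a.
Proof. by move=> p0; rewrite /lam_re gtr0_norm// ln_div ?posrE ?expR_gt0// expRK. Qed.

(* As a function of [ln p], the squared modulus of the symbol is strictly convex. *)
Lemma lam_sqr_min_unique a b C : (forall p, p != 0 -> C ^+ 2 <= lam_sqr a b p) ->
  forall p q, 0 < p -> 0 < q -> lam_sqr a b p = C ^+ 2 -> lam_sqr a b q = C ^+ 2 -> p = q.
Proof.
move=> hC p q p0 q0 hp hq; apply/ln_inj; rewrite ?posrE//; apply/eqP; rewrite -subr_eq0.
(* The geometric mean, the midpoint in the variable [ln p]. With [x = ln p] and [y = ln q], the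
   average of the two values exceeds the value at [m] by [((x - y) / 2) ^+ 2 + b ^+ 2 * (p - q) ^+ 2
   / 2]; minimality at [p] and [q] forces this to be [0]. *)
pose m := expR ((ln p + ln q) / 2).
have m0 : 0 < m by exact: expR_gt0.
have lnm : ln m = (ln p + ln q) / 2 by exact: expRK.
have mm : m * m = p * q.
  rewrite /m -expRD (_ : _ + _ = ln p + ln q); last by field.
  by rewrite expRD !lnK ?posrE.
have := hC m (lt0r_neq0 m0); move: hp hq.
rewrite /lam_sqr !lam_reE// /lam_im lnm => hp hq hm.
have bm : (- (b * m)) ^+ 2 = b ^+ 2 * (p * q) by rewrite -mm; ring.
rewrite bm in hm.
have : (ln p - ln q) ^+ 2 <= 0.
  have := sqr_ge0 (b * (p - q)); move: hp hq hm.
  by move: (ln p) (ln q) (C ^+ 2) => x y c hp hq hm; nra.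
by rewrite le_eqVlt ltNge sqr_ge0 orbF sqrf_eq0.
Qed.

(** The squared modulus is even with at most one positive minimiser [q], so the exceptional set is
    contained in [0], [q], [- q]. The point [0] is included because [ln 0 = 0] makes the symbol
    vanish there. *)
Lemma negligible_lam_min a b C : (forall p, p != 0 -> C ^+ 2 <= lam_sqr a b p) ->
  {ae mu, forall p, p != 0 /\ lam_sqr a b p != C ^+ 2}.
Proof.
move=> hC.
have [q hq] : exists q, forall p, 0 < p -> lam_sqr a b p = C ^+ 2 -> p = q.
  have [[q q0 qC]|nex] := pselect (exists2 q, 0 < q & lam_sqr a b q = C ^+ 2).
    by exists q => p p0 pC; exact: (lam_sqr_min_unique hC).
  (* A dummy value when the minimum is not attained. *)
  by exists 0 => p p0 pC; exfalso; apply: nex; exists p.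
exists ([set 0] `|` [set q] `|` [set - q]); split.
- by do 2?apply: measurableU; exact: measurable_set1.
- apply: countable_lebesgue_measure0; apply: finite_set_countable.
  by rewrite !finite_setU; split => //; split.
- move=> p /= /not_andP[|] /negP; rewrite negbK => /eqP pE; first by left; left.
  have [p0|p0|->] := ltgtP p 0; last by left; left.
  + right; have := hq (- p); rewrite oppr_gt0 lam_sqrN => /(_ p0 pE) <-.
    by rewrite opprK.
  + by left; right; exact: hq.
Qed.

Section bound.
Variables (a b C : R) (w h : R -> R).
Hypothesis C0 : 0 < C.
Hypothesis lamC : forall p, p != 0 -> C <= lam_abs a b p.
Hypothesis wh : solves_L a b w h.

Let hC p : p != 0 -> C ^+ 2 <= lam_sqr a b p.
Proof. by move=> p0; apply: lam_sqr_ge => //; exact: lamC. Qed.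

Let energies : exists Wr Wi Hr Hi : R -> R,
  [/\ [/\ inL2 Wr, inL2 Wi, inL2 Hr & inL2 Hi],
      sqint w = (\int[mu]_p (Wr p ^+ 2 + Wi p ^+ 2)%:E)%E,
      sqint h = (\int[mu]_p (Hr p ^+ 2 + Hi p ^+ 2)%:E)%E &
      {ae mu, forall p, [/\ p != 0, lam_sqr a b p != C ^+ 2 &
        Hr p ^+ 2 + Hi p ^+ 2 = lam_sqr a b p * (Wr p ^+ 2 + Wi p ^+ 2)]}].
Proof.
have [w2 [h2 [Wr [Wi [Hr [Hi [Fw [Fh eq]]]]]]]] := wh.
have [Wr2 [Wi2 _]] := Fw; have [Hr2 [Hi2 _]] := Fh.
have sumE (f g : R -> R) : inL2 f -> inL2 g ->
    (sqint f + sqint g = \int[mu]_p (f p ^+ 2 + g p ^+ 2)%:E)%E.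
  move=> [mf _] [mg _]; rewrite -ge0_integralD//.
  - by move=> p _; rewrite lee_fin sqr_ge0.
  - exact: measurable_sqr.
  - by move=> p _; rewrite lee_fin sqr_ge0.
  - exact: measurable_sqr.
exists Wr, Wi, Hr, Hi; split => //.
- by rewrite -sumE//; exact: plancherel.
- by rewrite -sumE//; exact: plancherel.
move: eq (negligible_lam_min hC); apply: ae_imply2 => p [<- <-] [p0 pC]; split => //.
by rewrite /lam_sqr; ring.
Qed.

Let msum (f g : R -> R) : inL2 f -> inL2 g ->
  measurable_fun setT (fun p => (f p ^+ 2 + g p ^+ 2)).
Proof. by move=> [mf _] [mg _]; apply: measurable_funD; exact: measurable_funX. Qed.

Lemma solves_L_bound : C ^+ 2 * fine (sqint w) <= fine (sqint h).
Proof.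
have [Wr [Wi [Hr [Hi [[Wr2 Wi2 Hr2 Hi2] wE hE eq]]]]] := energies.
have [/inL2P[_ wy] [/inL2P[_ hy] _]] := wh.
rewrite -lee_fin EFinM !fineK ?sqint_fin_num// wE hE.
rewrite -ge0_integralZl_EFin ?sqr_ge0//; last 2 first.
- by move=> p _; rewrite lee_fin addr_ge0 ?sqr_ge0.
- by apply/measurable_EFinP; exact: msum.
apply: ae_ge0_le_integral => //.
- by move=> p _; rewrite mule_ge0 ?lee_fin ?addr_ge0 ?sqr_ge0.
- by apply: measurable_funeM; apply/measurable_EFinP; exact: msum.
- by move=> p _; rewrite lee_fin addr_ge0 ?sqr_ge0.
- by apply/measurable_EFinP; exact: msum.
move: eq; apply: ae_imply => p [p0 _ ->] _.
by rewrite -EFinM lee_fin ler_wpM2r ?hC// addr_ge0 ?sqr_ge0.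
Qed.

Lemma solves_L_bound_eq0 : fine (sqint h) <= C ^+ 2 * fine (sqint w) ->
  fine (sqint w) = 0.
Proof.
have [Wr [Wi [Hr [Hi [[Wr2 Wi2 Hr2 Hi2] wE hE eq]]]]] := energies.
have [/inL2P[_ wy] [/inL2P[_ hy] _]] := wh => le_hw.
pose W p := Wr p ^+ 2 + Wi p ^+ 2; pose H p := Hr p ^+ 2 + Hi p ^+ 2.
have W0 p : 0 <= W p by rewrite addr_ge0 ?sqr_ge0.
have H0 p : 0 <= H p by rewrite addr_ge0 ?sqr_ge0.
have mW : measurable_fun setT W by exact: msum.
have mH : measurable_fun setT H by exact: msum.
have iW : mu.-integrable setT (EFin \o W).
  apply/integrableP; split; first exact/measurable_EFinP.
  under eq_integral => p _ do rewrite /= ger0_norm//.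
  by rewrite -wE.
have iH : mu.-integrable setT (EFin \o H).
  apply/integrableP; split; first exact/measurable_EFinP.
  under eq_integral => p _ do rewrite /= ger0_norm//.
  by rewrite -hE.
have iCW := integrableZl measurableT (C ^+ 2) iW.
(* Almost everywhere [g] is [(lam_sqr a b p - C ^+ 2) * W p], hence nonnegative, and the hypothesis
   makes its integral nonpositive. So [g = 0] a.e., and the first factor is nonzero a.e. *)
pose g p := H p - C ^+ 2 * W p.
have mg : measurable_fun setT g.
  by apply: measurable_funB => //; exact: measurable_funM.
have g_ge0 : {ae mu, forall p, 0 <= g p}.
  move: eq; apply: ae_imply => p [p0 _ e].
  by rewrite /g /H e -/(W p) -mulrBl mulr_ge0// subr_ge0 hC.
have ig : (\int[mu]_p `|(g p)%:E| = 0)%E.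
  have gE : (\int[mu]_p `|(g p)%:E| = \int[mu]_p (g p)%:E)%E.
    apply: ae_eq_integral => //.
    - by apply: measurableT_comp => //; exact/measurable_EFinP.
    - exact/measurable_EFinP.
    - by move: g_ge0; apply: ae_imply => p gp _; rewrite /= ger0_norm.
  apply/eqP; rewrite eq_le integral_ge0// andbT gE.
  rewrite (@integralB_EFin _ _ _ mu setT H (fun p => C ^+ 2 * W p))//.
  rewrite -hE; under eq_integral do rewrite EFinM.
  rewrite integralZl// -wE -[sqint h]fineK ?sqint_fin_num//.
  by rewrite -[sqint w]fineK ?sqint_fin_num// -EFinM -EFinB lee_fin subr_le0.
have /ae_eq_integral_abs g0 : (\int[mu]_p `|(g p)%:E| = 0)%E by [].
have {}g0 := g0 measurableT ((measurable_EFinP _ _).2 mg).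
suff -> : sqint w = 0%E by [].
rewrite wE -(@integral0 _ _ _ mu setT); apply: ae_eq_integral => //.
- exact/measurable_EFinP.
- move: eq g0; apply: ae_imply2 => p [p0 pC e] /(_ I) /= [ge] _; congr EFin.
  move: ge; rewrite /g /H e -/(W p) -mulrBl => /eqP.
  by rewrite mulf_eq0 subr_eq0 (negbTE pC)/= => /eqP.
Qed.

End bound.
End logarithmic_operator.

(** * Young's inequality *)

Section young.
Context {R : realType}.
Local Notation mu := (@lebesgue_measure R).
Local Notation Rint := (Rintegral mu setT).
Implicit Types (x y : R) (G h : R -> R).

(** Cauchy-Schwarz, squared so that it reads in terms of [sqint] and permits infinite values. *)
Lemma integral_abs_mul_sqr_le (f g : R -> R) :
  measurable_fun setT f -> measurable_fun setT g ->
  ((\int[mu]_y `|f y * g y|%:E) * (\int[mu]_y `|f y * g y|%:E) <= sqint f * sqint g)%E.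
Proof.
move=> mf mg.
have half2 : 2^-1 + 2^-1 = 1 :> R by field.
have := @hoelder _ _ _ mu f g 2 2 mf mg (ltr0n _ 2) (ltr0n _ 2) half2.
rewrite Lnorm1 -!/(L2norm _) => le_h.
have -> : (sqint f * sqint g = (L2norm f * L2norm g) * (L2norm f * L2norm g))%E.
  by rewrite -!L2norm_sqr muleACA.
have i0 : (0 <= \int[mu]_y `|f y * g y|%:E)%E by exact: integral_ge0.
exact: lee_pmul.
Qed.

Variable K : R -> R.
Hypothesis K1 : inL1 K.

Let k := fine (L1norm K).

Let mK : measurable_fun setT K. Proof. by case: K1. Qed.

Let intK : (\int[mu]_x `|K x|%:E = k%:E)%E.
Proof.
have [_] := K1; rewrite /k /L1norm Lnorm1 => Ky.
by rewrite fineK// ge0_fin_numE// integral_ge0.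
Qed.

Let k0 : 0 <= k. Proof. by rewrite fine_ge0// Lnorm_ge0. Qed.

Let mnK : measurable_fun setT (fun x => `|K x|%:E).
Proof. by apply/measurable_EFinP; exact: measurableT_comp. Qed.

Let mKB x : measurable_fun setT (fun y => K (x - y)).
Proof.
apply: (measurableT_comp mK); apply: measurable_funB => //; exact: measurable_cst.
Qed.

(** The convolutions of [|K|] with [G ^+ 2] and with [|G|]. Young's inequality splits into
    [J ^+ 2 <= k * V] pointwise and, by Tonelli, the total mass [k * sqint G] of [V]. *)
Let V G x : \bar R := (\int[mu]_y (`|K (x - y)| * G y ^+ 2)%:E)%E.
Let J G x : \bar R := (\int[mu]_y `|K (x - y) * G y|%:E)%E.

Let mVG G : measurable_fun setT G ->
  measurable_fun setT (fun z : R * R => (`|K (z.1 - z.2)| * G z.2 ^+ 2)%:E).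
Proof.
move=> mG; apply/measurable_EFinP; apply: measurable_funM.
  apply: measurableT_comp => //; apply: (measurableT_comp mK).
  exact: measurable_funB.
by apply: measurable_funX; exact: measurableT_comp.
Qed.

Let VG0 G (z : R * R) : (0 <= (`|K (z.1 - z.2)| * G z.2 ^+ 2)%:E)%E.
Proof. by rewrite lee_fin mulr_ge0// sqr_ge0. Qed.

Let measurable_V G : measurable_fun setT G -> measurable_fun setT (V G).
Proof.
move=> mG.
exact: (@measurable_fun_fubini_tonelli_F _ _ _ _ R mu _ (mVG mG) (@VG0 G)).
Qed.

Let V_ge0 G x : (0 <= V G x)%E.
Proof. by apply: integral_ge0 => y _; rewrite lee_fin mulr_ge0// sqr_ge0. Qed.

Let integral_V G : measurable_fun setT G -> (\int[mu]_x V G x = k%:E * sqint G)%E.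
Proof.
move=> mG; rewrite /V.
rewrite (@fubini_tonelli _ _ _ _ R mu mu _ (mVG mG) (@VG0 G)).
rewrite -ge0_integralZl_EFin//; last 2 first.
- by move=> y _; rewrite lee_fin sqr_ge0.
- exact: measurable_sqr.
apply: eq_integral => y _ /=.
under eq_integral do rewrite mulrC EFinM.
rewrite ge0_integralZl_EFin ?sqr_ge0//; last first.
  by apply/measurable_EFinP; apply: measurableT_comp => //; apply: (measurableT_comp mK);
    apply: measurable_funB => //; exact: measurable_cst.
by rewrite (@ge0_integral_translation _ y (fun x => `|K x|%:E))// intK muleC.
Qed.

(** Cauchy-Schwarz with [|K|] written as the product of two square roots, one of which is kept with
    [G]. *)
Let J_sqr G x : measurable_fun setT G -> (J G x * J G x <= k%:E * V G x)%E.
Proof.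
move=> mG.
have msqrt : measurable_fun setT (fun y => Num.sqrt `|K (x - y)|).
  apply: (measurableT_comp (f := @Num.sqrt R)).
    by apply: continuous_measurable_fun; exact: sqrt_continuous.
  exact: measurableT_comp.
have := integral_abs_mul_sqr_le msqrt (measurable_funM msqrt mG).
have -> : (\int[mu]_y `|Num.sqrt `|K (x - y)| * (Num.sqrt `|K (x - y)| * G y)|%:E = J G x)%E.
  apply: eq_integral => y _; congr EFin.
  by rewrite mulrA -expr2 sqr_sqrtr// !normrM normr_id.
have -> : sqint (fun y => Num.sqrt `|K (x - y)|) = k%:E.
  rewrite -intK -(@ge0_integral_reflection _ x (fun y => `|K y|%:E))//.
  by apply: eq_integral => y _; rewrite sqr_sqrtr.
congr (_ <= _ * _)%E; apply: eq_integral => y _.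
by rewrite exprMn sqr_sqrtr.
Qed.

Let ae_V G : inL2 G -> {ae mu, forall x, (V G x < +oo)%E}.
Proof.
move=> /inL2P[mG Gy].
have iV : mu.-integrable setT (V G).
  apply/integrableP; split; first exact: measurable_V.
  under eq_integral => x _ do rewrite gee0_abs//.
  by rewrite integral_V// lte_mul_pinfty// lee_fin.
move: (integrable_ae measurableT iV); apply: ae_imply => x /(_ I).
by rewrite ge0_fin_numE.
Qed.

(** A finite [V] bounds the square of [J], so [J] is finite as well. *)
Let integrable_KG G x : measurable_fun setT G -> (V G x < +oo)%E ->
  mu.-integrable setT (EFin \o (fun y => K (x - y) * G y)).
Proof.
move=> mG Vy; apply/integrableP; split.
  by apply/measurable_EFinP; exact: (measurable_funM (mKB x) mG).
change (J G x < +oo)%E.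
have J0 : (0 <= J G x)%E by exact: integral_ge0.
have := J_sqr x mG; have : (k%:E * V G x < +oo)%E by rewrite lte_mul_pinfty.
case: (J G x) J0 => [r| |]//= _; rewrite ?ltry// mulyy => h1 h2.
by have := le_lt_trans h2 h1.
Qed.

(** The two convolutions may be subtracted under the integral at every [x] where [V G1] and [V G2]
    are finite, which is almost every [x]. *)
Lemma young_sub (e : R) G1 G2 h1 h2 : 0 <= e -> inL2 G1 -> inL2 G2 ->
  measurable_fun setT h1 -> measurable_fun setT h2 ->
  (forall x, h1 x = e * convol K G1 x) -> (forall x, h2 x = e * convol K G2 x) ->
  (sqint (fun x => (h1 x - h2 x)%R) <=
    ((e * k) ^+ 2)%:E * sqint (fun x => (G1 x - G2 x)%R))%E.
Proof.
move=> e0 G12 G22 mh1 mh2 h1E h2E.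
have [mG1 _] := G12; have [mG2 _] := G22.
have G2' := inL2B G12 G22; have [mG _] := G2'.
set G := (fun x => G1 x - G2 x) in G2' mG *.
apply: (@le_trans _ _ (\int[mu]_x ((e ^+ 2 * k)%:E * V G x))%E); last first.
  rewrite ge0_integralZl_EFin//; last 2 first.
  - exact: measurable_V.
  - by rewrite mulr_ge0// sqr_ge0.
  by rewrite integral_V// muleA -EFinM exprMn expr2 (expr2 k) mulrA.
apply: ae_ge0_le_integral => //.
- by move=> x _; rewrite lee_fin sqr_ge0.
- by apply: measurable_sqr; exact: measurable_funB.
- by move=> x _; rewrite mule_ge0// lee_fin mulr_ge0// sqr_ge0.
- by apply: measurable_funeM; exact: measurable_V.
move: (ae_V G12) (ae_V G22); apply: ae_imply2 => x V1 V2 _.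
have i1 := integrable_KG mG1 V1; have i2 := integrable_KG mG2 V2.
have -> : h1 x - h2 x = e * Rint (fun y => K (x - y) * G y).
  rewrite h1E h2E -mulrBr /convol -RintegralB//; congr (_ * _).
  by apply: eq_Rintegral => y _; rewrite -mulrBr.
rewrite exprMn EFinM [leRHS](_ : _ = ((e ^+ 2)%:E * (k%:E * V G x))%E); last first.
  by rewrite muleA.
rewrite lee_wpmul2l ?lee_fin ?sqr_ge0//.
apply: le_trans (J_sqr x mG).
rewrite -(real_normK (num_real (Rint _))) expr2 EFinM.
have mKG : measurable_fun setT (fun y => K (x - y) * G y).
  exact: (measurable_funM (mKB x) mG).
have := normr_Rintegral_le mKG; rewrite -/(J G x) => le_J.
by apply: lee_pmul; rewrite ?lee_fin.
Qed.

End young.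

(** * Lipschitz bounds *)

Section euclidean.
Context {R : realType} {N : nat}.
Implicit Types (a b : 'I_N -> R).

Definition enorm a : R := Num.sqrt (\sum_(i < N) a i ^+ 2).

Lemma enorm_ge0 a : 0 <= enorm a. Proof. exact: sqrtr_ge0. Qed.

Lemma sumsq_ge0 a : 0 <= \sum_(i < N) a i ^+ 2.
Proof. by apply: sumr_ge0 => i _; exact: sqr_ge0. Qed.

Lemma enorm_sqr a : enorm a ^+ 2 = \sum_(i < N) a i ^+ 2.
Proof. by rewrite sqr_sqrtr// sumsq_ge0. Qed.

(** Lagrange's identity: the deficit of the squares is half the sum of all squared minors
    [a i * b j - a j * b i]. *)
Lemma cauchy_schwarz_sum a b : `|\sum_(i < N) a i * b i| <= enorm a * enorm b.
Proof.
rewrite -ler_sqr ?nnegrE ?mulr_ge0 ?enorm_ge0// exprMn !enorm_sqr.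
rewrite real_normK ?num_real// -subr_ge0.
have -> : (\sum_(i < N) a i ^+ 2) * (\sum_(i < N) b i ^+ 2) - (\sum_(i < N) a i * b i) ^+ 2 =
    2^-1 * \sum_(i < N) \sum_(j < N) (a i * b j - a j * b i) ^+ 2.
  have E1 : (\sum_(i < N) a i ^+ 2) * (\sum_(i < N) b i ^+ 2) =
      \sum_(i < N) \sum_(j < N) a i ^+ 2 * b j ^+ 2.
    by rewrite mulr_suml; apply: eq_bigr => i _; rewrite mulr_sumr.
  have E2 : (\sum_(i < N) a i * b i) ^+ 2 =
      \sum_(i < N) \sum_(j < N) (a i * b i) * (a j * b j).
    by rewrite expr2 mulr_suml; apply: eq_bigr => i _; rewrite mulr_sumr.
  have E3 : \sum_(i < N) \sum_(j < N) a j ^+ 2 * b i ^+ 2 =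
      \sum_(i < N) \sum_(j < N) a i ^+ 2 * b j ^+ 2 by rewrite exchange_big.
  have -> : \sum_(i < N) \sum_(j < N) (a i * b j - a j * b i) ^+ 2 =
      \sum_(i < N) \sum_(j < N) a i ^+ 2 * b j ^+ 2 +
      \sum_(i < N) \sum_(j < N) a j ^+ 2 * b i ^+ 2 -
      2 * \sum_(i < N) \sum_(j < N) (a i * b i) * (a j * b j).
    rewrite mulr_sumr -big_split/= -sumrB; apply: eq_bigr => i _.
    rewrite mulr_sumr -big_split/= -sumrB; apply: eq_bigr => j _; ring.
  by rewrite E3 E1 E2; field.
rewrite mulr_ge0 ?invr_ge0//.
by apply: sumr_ge0 => i _; apply: sumr_ge0 => j _; exact: sqr_ge0.
Qed.

Lemma enormD a b : enorm (fun i => a i + b i) <= enorm a + enorm b.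
Proof.
rewrite -ler_sqr ?nnegrE ?addr_ge0 ?enorm_ge0// sqrrD !enorm_sqr.
have -> : \sum_(i < N) (a i + b i) ^+ 2 =
    \sum_(i < N) a i ^+ 2 + \sum_(i < N) b i ^+ 2 + 2 * \sum_(i < N) a i * b i.
  by rewrite mulr_sumr -!big_split; apply: eq_bigr => i _ /=; ring.
have := cauchy_schwarz_sum a b; have := ler_norm (\sum_(i < N) a i * b i).
by rewrite -mulr_natl; lra.
Qed.

End euclidean.

Section lipschitz.
Context {R : realType} {N : nat}.
Implicit Types (G : 'rV[R]_N -> R) (x y : 'rV[R]_N).

Lemma derive_sum_partial G x v : differentiable G x ->
  'D_v G x = \sum_(i < N) v 0 i * partial G i x.
Proof.
move=> dG; rewrite deriveE// {1}[v]row_sum_delta linear_sum; apply: eq_bigr => i _.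
by rewrite linearZ /partial deriveE.
Qed.

(** The mean value theorem on the segment from [y] to [x] asks only for a derivative at each point,
    and Cauchy-Schwarz matches the Euclidean length of the gradient with that of [x - y]. *)
Lemma grad_bound_lipschitz G (s : R) : (forall x, differentiable G x) ->
  (forall x, enorm (fun i => partial G i x) <= s) ->
  forall x y, `|G x - G y| <= s * enorm (fun i => x 0 i - y 0 i).
Proof.
move=> dG Gs x y; pose v := x - y.
pose phi (t : R) := G (y + t *: v).
have dphi (t : R) : is_derive t (1 : R) phi ('D_v G (y + t *: v)).
  (* The difference quotients of [phi] at [t] are those of [G] in direction [v], so derivability and
     the value of the derivative transfer together. *)
  have E : (fun h : R => h^-1 *: ((phi \o shift t) (h *: 1) - phi t)) =
           (fun h : R => h^-1 *: ((G \o shift (y + t *: v)) (h *: v) - G (y + t *: v))).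
    apply/funext => h; rewrite /phi /=; congr (_ *: (G _ - _)).
    rewrite (_ : h *: 1 = h); last exact: mulr1.
    by rewrite scalerDl addrCA.
  have dv : derivable G (y + t *: v) v by exact: diff_derivable.
  by apply: DeriveDef; rewrite /derivable /derive E.
have cphi : {within `[0, 1], continuous phi}.
  by apply: continuous_subspaceT => t; exact: is_derive_continuous (dphi t).
have [c _] := MVT ltr01 (fun t _ => dphi t) cphi.
rewrite /phi scale1r scale0r addr0 subr0 mulr1 subrKC => ->.
rewrite derive_sum_partial//.
have -> : (fun i => x 0 i - y 0 i) = (fun i => v 0 i).
  by apply/funext => i; rewrite /v !mxE.
rewrite (le_trans (cauchy_schwarz_sum _ _))// mulrC.
by rewrite ler_wpM2r ?enorm_ge0.
Qed.

Lemma supnorm_vec_ge (F : 'rV[R]_N -> 'I_N -> R) x :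
  ((enorm (F x))%:E <= supnorm_vec F)%E.
Proof. by apply: ereal_sup_ubound; exists x. Qed.

Lemma supnorm_vec_ge0 (F : 'rV[R]_N -> 'I_N -> R) : (0 <= supnorm_vec F)%E.
Proof.
by apply: le_trans (supnorm_vec_ge F 0); rewrite lee_fin enorm_ge0.
Qed.

Lemma grad_supnorm_lipschitz G : (forall x, differentiable G x) ->
  (grad_supnorm G < +oo)%E -> forall x y,
  `|G x - G y| <= fine (grad_supnorm G) * enorm (fun i => x 0 i - y 0 i).
Proof.
move=> dG Gy; apply: grad_bound_lipschitz => // x.
rewrite -lee_fin fineK; last by rewrite ge0_fin_numE// supnorm_vec_ge0.
exact: (supnorm_vec_ge (fun x i => partial G i x)).
Qed.

Lemma grad_diff_supnorm_lipschitz G1 G2 : (forall x, differentiable G1 x) ->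
  (forall x, differentiable G2 x) -> (grad_diff_supnorm G1 G2 < +oo)%E -> forall x y,
  `|(G1 x - G2 x) - (G1 y - G2 y)| <=
    fine (grad_diff_supnorm G1 G2) * enorm (fun i => x 0 i - y 0 i).
Proof.
move=> dG1 dG2 Gy.
apply: (@grad_bound_lipschitz (fun x => G1 x - G2 x)) => x.
  exact: differentiableB.
rewrite -lee_fin fineK; last by rewrite ge0_fin_numE// supnorm_vec_ge0.
have -> : (fun i => partial (fun x => G1 x - G2 x) i x) =
    (fun i => partial G1 i x - partial G2 i x).
  by apply/funext => i; rewrite /partial deriveB//; exact: diff_derivable.
exact: (supnorm_vec_ge (fun x i => partial G1 i x - partial G2 i x)).
Qed.

(* Preimages of open sets are countable unions of measurable sets, since open
   sets are countable unions of rational boxes. *)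
Lemma measurable_continuous_row G (u : 'I_N -> R -> R) : continuous G ->
  (forall k, measurable_fun setT (u k)) ->
  measurable_fun setT (fun y : R => G (\row_k u k y)).
Proof.
move=> cG mu_.
apply: (measurability _ (RGenOpens.measurableE R)) => _ [_ [a [b ->] <-]].
rewrite setTI; pose U := G @^-1` `]a, b[%classic.
have oU : open U by move/continuousP : cG; apply; exact: interval_open.
pose box (i : {ffun 'I_N -> rat} * nat) : set 'rV[R]_N :=
  [set x | forall k, `|x 0 k - ratr (i.1 k)| < i.2.+1%:R^-1].
have -> : (fun y : R => G (\row_k u k y)) @^-1` `]a, b[%classic =
    \bigcup_(i in [set i | box i `<=` U]) [set y : R | box i (\row_k u k y)].
  apply/seteqP; split => [y Uy|y [i /= iU yi]]; last exact: (iU _ yi).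
  have [e /= e0 eU] : exists2 e : R, 0 < e & ball (\row_k u k y) e `<=` U.
    by have /nbhs_ballP[e] := open_nbhs_nbhs (conj oU Uy); exists e.
  (* Two points of one box then differ by less than [e] in each coordinate, and balls of row vectors
     are coordinatewise. *)
  have [n ne] : exists n, n.+1%:R^-1 < e / 2.
    have e2 : 0 < e / 2 by rewrite divr_gt0.
    by near \oo => n; exists n; near: n; exact: near_infty_natSinv_lt (PosNum e2).
  have n0 : 0 < n.+1%:R^-1 :> R by rewrite invr_gt0.
  have rq k : exists q, `|u k y - ratr q| < n.+1%:R^-1.
    move: (n.+1%:R^-1) n0 => r r0.
    have : u k y - r < u k y + r by lra.
    move=> /rat_in_itvoo[q]; rewrite in_itv/= => /andP[q1 q2]; exists q.
    by rewrite ltr_norml; apply/andP; split; lra.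
  pose q := [ffun k => projT1 (cid (rq k))].
  have qP k : `|u k y - ratr (q k)| < n.+1%:R^-1.
    by rewrite ffunE; exact: projT2 (cid (rq k)).
  exists (q, n) => /=; last by move=> k; rewrite mxE; exact: qP.
  move=> x xb; apply: eU; split => // i k; rewrite ord1 mxE /ball/=.
  rewrite (_ : u k y - x 0 k = (u k y - ratr (q k)) - (x 0 k - ratr (q k))); last by ring.
  rewrite (le_lt_trans (ler_normB _ _))//; have := xb k; have := qP k; move: ne => /=.
  by move: (n.+1%:R^-1) => r; lra.
rewrite bigcup_mkcond; apply: countable_bigcupT_measurable => [|i]; first exact: countableP.
case: ifP => // _.
have -> : [set y : R | box i (\row_k u k y)] =
    \bigcap_(k in [set: 'I_N]) [set y : R | `|u k y - ratr (i.1 k)| < i.2.+1%:R^-1].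
  apply/seteqP; split => y /= h k; first by move=> _; have := h k; rewrite mxE.
  by rewrite mxE; exact: h.
apply: fin_bigcap_measurable => // k _.
rewrite -[X in measurable X]setTI.
have mk : measurable_fun setT (fun y : R => `|u k y - ratr (i.1 k)|).
  by apply: measurableT_comp => //; apply: measurable_funB => //; exact: measurable_cst.
have := measurable_fun_ltr mk (measurable_cst (i.2.+1%:R^-1 : R)).
by move=> /(_ measurableT [set true]); apply.
Unshelve. all: by end_near. Qed.

End lipschitz.

(** * Main estimate *)

Section vector_norm.
Context {R : realType} {N : nat}.
Implicit Types u v : 'I_N -> R -> R.

Lemma L2vnorm_sqr u : L2vnorm u ^+ 2 = \sum_(m < N) fine (sqint (u m)).
Proof.
rewrite sqr_sqrtr; last by apply: sumr_ge0 => m _; exact: sqr_ge0.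
by apply: eq_bigr => m _; rewrite fine_L2norm_sqr.
Qed.

Lemma L2vnorm_ge0 u : 0 <= L2vnorm u. Proof. exact: sqrtr_ge0. Qed.

Lemma sqint_enorm u : (forall m, measurable_fun setT (u m)) ->
  sqint (fun y => enorm (u ^~ y)) = (\sum_(m < N) sqint (u m))%E.
Proof.
move=> mu_; rewrite -ge0_integral_sum//.
- by apply: eq_integral => y _; rewrite enorm_sqr sumEFin.
- by move=> m; exact: measurable_sqr.
- by move=> m y _; rewrite lee_fin sqr_ge0.
Qed.

Lemma inL2_enorm u : (forall m, inL2 (u m)) -> inL2 (fun y => enorm (u ^~ y)).
Proof.
move=> u2; apply/inL2P; split.
  apply: (measurableT_comp (f := @Num.sqrt R)).
    by apply: continuous_measurable_fun; exact: sqrt_continuous.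
  apply: measurable_sum => m; apply: measurable_funX; by case: (u2 m).
rewrite sqint_enorm; last by move=> m; case: (u2 m).
by apply: lte_sum_pinfty => m _; have /inL2P[] := u2 m.
Qed.

Lemma fine_L2norm_enorm u : (forall m, inL2 (u m)) ->
  fine (L2norm (fun y => enorm (u ^~ y))) = L2vnorm u.
Proof.
move=> u2; apply/eqP; rewrite -(@eqrXn2 _ 2)// ?L2vnorm_ge0 ?fine_ge0 ?L2norm_ge0//.
rewrite fine_L2norm_sqr L2vnorm_sqr sqint_enorm; last by move=> m; case: (u2 m).
by rewrite sum_fine// => m _; rewrite sqint_fin_num//; have /inL2P[] := u2 m.
Qed.

(** The vector norm is the scalar L^2 norm of the pointwise Euclidean length, so the Euclidean
    triangle inequality reduces the claim to Minkowski's. *)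
Lemma L2vnormD u v : (forall m, inL2 (u m)) -> (forall m, inL2 (v m)) ->
  L2vnorm (fun m x => u m x + v m x) <= L2vnorm u + L2vnorm v.
Proof.
move=> u2 v2; have uv2 m : inL2 (fun x => u m x + v m x) by exact: inL2D.
rewrite -!fine_L2norm_enorm//.
have Eu := inL2_enorm u2; have Ev := inL2_enorm v2.
apply: le_trans (fine_L2normD Eu Ev).
apply: fine_L2norm_le; [by case: (inL2_enorm uv2)|exact: inL2D|] => x.
rewrite !ger0_norm ?addr_ge0 ?enorm_ge0//; exact: enormD.
Qed.

Lemma L2vnormN u : L2vnorm (fun m x => - u m x) = L2vnorm u.
Proof.
congr Num.sqrt; apply: eq_bigr => m _.
by rewrite !fine_L2norm_sqr sqintN.
Qed.

End vector_norm.

Section source_bound.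
Context {R : realType}.
Variables (a b C e : R) (K : R -> R).
Hypothesis C0 : 0 < C.
Hypothesis lamC : forall p, p != 0 -> C <= lam_abs a b p.
Hypothesis K1 : inL1 K.
Hypothesis e0 : 0 <= e.

Lemma fine_young_sub (G1 G2 h1 h2 : R -> R) : inL2 G1 -> inL2 G2 ->
  inL2 h1 -> inL2 h2 ->
  (forall x, h1 x = e * convol K G1 x) -> (forall x, h2 x = e * convol K G2 x) ->
  fine (L2norm (fun x => h1 x - h2 x)) <=
    e * fine (L1norm K) * fine (L2norm (fun x => G1 x - G2 x)).
Proof.
move=> G12 G22 h12 h22 h1E h2E.
have ek0 : 0 <= e * fine (L1norm K) by rewrite mulr_ge0// fine_ge0// Lnorm_ge0.
have /inL2P[_ Gy] := inL2B G12 G22; have /inL2P[_ hy] := inL2B h12 h22.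
rewrite -(@ler_sqr _ (fine _)) ?nnegrE ?mulr_ge0 ?fine_ge0 ?L2norm_ge0 ?Lnorm_ge0//.
rewrite [leRHS]exprMn !fine_L2norm_sqr -lee_fin EFinM !fineK ?sqint_fin_num//.
by apply: young_sub => //; [case: h12|case: h22].
Qed.

Lemma source_difference_bound (w1 w2 G1 G2 : R -> R) : inL2 G1 -> inL2 G2 ->
  solves_L a b w1 (fun x => e * convol K G1 x) ->
  solves_L a b w2 (fun x => e * convol K G2 x) ->
  C * fine (L2norm (fun x => w1 x - w2 x)) <=
    e * fine (L1norm K) * fine (L2norm (fun x => G1 x - G2 x)).
Proof.
move=> G12 G22 s1 s2; have [_ [h12 _]] := s1; have [_ [h22 _]] := s2.
apply: le_trans (fine_young_sub G12 G22 h12 h22 (fun=> erefl) (fun=> erefl)).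
rewrite -ler_sqr ?nnegrE ?mulr_ge0 ?(ltW C0) ?fine_ge0 ?L2norm_ge0//.
rewrite exprMn !fine_L2norm_sqr.
exact: solves_L_bound (solves_LB s1 s2).
Qed.

(** The difference estimate against the zero function, whose convolution is [0]. *)
Lemma source_bound (G : R -> R) : inL2 G -> inL2 (fun x => e * convol K G x) ->
  fine (L2norm (fun x => e * convol K G x)) <=
    e * fine (L1norm K) * fine (L2norm G).
Proof.
move=> G2 h2.
have zero2 : inL2 (cst 0 : R -> R).
  by apply: (inL2_le _ G2) => // x; rewrite normr0.
have z x : 0 = e * convol K (cst 0) x.
  rewrite /convol; under eq_Rintegral do rewrite mulr0.
  by rewrite /Rintegral integral0 mulr0.
have := fine_young_sub G2 zero2 h2 zero2 (fun=> erefl) z.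
under [X in L2norm X]eq_fun do rewrite subr0.
by under [X in _ * fine (L2norm X)]eq_fun do rewrite subr0.
Qed.

End source_bound.

Unset Implicit Arguments.

Theorem theorem4 (R : realType) (N : nat) (a b : 'I_N -> R)
  (f : 'I_N -> R -> R) (K : 'I_N -> R -> R) (M C rho : R)
  (g : bool -> 'I_N -> 'rV[R]_N -> R) (eps : 'I_N -> R)
  (u0 : 'I_N -> R -> R) (up : bool -> 'I_N -> R -> R) :
  (0 < N)%N ->
  (forall m, b m != 0) ->
  (forall m, inL2 (f m)) ->
  (exists m x, f m x != 0) ->
  (forall m, inL1 (K m)) ->
  let Kc := Num.sqrt (\sum_(m < N) (fine (L1norm (K m))) ^+ 2) in
  0 < Kc ->
  0 < M ->
  (forall j m x, differentiable (g j m) x) ->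
  (forall j m, g j m 0 = 0) ->
  (forall j, exists m x, g j m x != 0) ->
  (forall j, (\sum_(m < N) grad_supnorm (g j m) <= M%:E)%E) ->
  0 < C ->
  (forall m p, p != 0 -> C <= lam_abs (a m) (b m) p) ->
  (forall m, solves_L (a m) (b m) (u0 m) (f m)) ->
  0 < rho -> rho <= 1 ->
  (forall m, 0 <= eps m) ->
  let e := \big[Num.max/0]_(m < N) eps m in
  0 < e ->
  e <= rho * C / (M * Kc * (L2vnorm u0 + 1)) ->
  (* u_{p,j} is the fixed point of T_{g_j} in B_rho *)
  (forall j, L2vnorm (up j) <= rho) ->
  (forall j m, solves_L (a m) (b m) (up j m)
      (fun x => eps m * convol (K m)
         (fun y => g j m (\row_(k < N) (u0 k y + up j k y))) x)) ->
  let sigma := e * M * Kc / C in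
  let u := fun j m x => u0 m x + up j m x in
  ((L2vnorm (fun m x => u true m x - u false m x))%:E <=
    (e / (1 - sigma) * (Kc / C) * (L2vnorm u0 + 1))%:E *
    \sum_(m < N) grad_diff_supnorm (g true m) (g false m))%E.

Proof.
move=> N0 b0 f2 fn0 K1 Kc Kc0 M0 dg g00 gn0 gM C0 lamC u0f rho0 rho1 eps0 e e0 ebound
  up_rho up_sol.
pose sigma := e * M * Kc / C; pose u j m x := u0 m x + up j m x.
change ((L2vnorm (fun m x => u true m x - u false m x))%:E <=
  (e / (1 - sigma) * (Kc / C) * (L2vnorm u0 + 1))%:E *
  \sum_(m < N) grad_diff_supnorm (g true m) (g false m))%E.
have u02 m : inL2 (u0 m) by case: (u0f m).
have up2 j m : inL2 (up j m) by case: (up_sol j m).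
have u2 j m : inL2 (u j m) by exact: inL2D.
pose n0 := L2vnorm u0; have n00 : 0 <= n0 := L2vnorm_ge0 u0.
have epsm m : eps m <= e by rewrite /e; exact: le_bigmax.
pose k m := fine (L1norm (K m)).
have k0 m : 0 <= k m by rewrite fine_ge0// Lnorm_ge0.
have gfin j m : (grad_supnorm (g j m) < +oo)%E.
  apply: le_lt_trans (ltry M); apply: le_trans (gM j).
  rewrite (bigD1 m)//= leeDl// sume_ge0// => i _; exact: supnorm_vec_ge0.
pose s j m := fine (grad_supnorm (g j m)).
have s0 j m : 0 <= s j m by rewrite fine_ge0// supnorm_vec_ge0.
have sM j : \sum_(m < N) s j m <= M.
  rewrite -lee_fin -sumEFin; apply: le_trans (gM j); apply: lee_sum => m _.
  by rewrite fineK// ge0_fin_numE// supnorm_vec_ge0.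
have s_leM j m : s j m <= M.
  apply: le_trans (sM j); rewrite (bigD1 m)//= lerDl; exact: sumr_ge0.
pose G j m y := g j m (\row_(i < N) (u0 i y + up j i y)).
have mG j m : measurable_fun setT (G j m).
  apply: (@measurable_continuous_row _ _ (g j m) (u j)).
    by move=> x; exact: differentiable_continuous.
  by move=> i; case: (u2 j i).
have mE j : inL2 (fun y => enorm ((u j) ^~ y)) by exact: inL2_enorm.
(* Since [g j m] vanishes at [0], its Lipschitz bound is a linear growth bound, which puts [G j m]
   in L^2. *)
have G_le j m y : `|G j m y| <= `|s j m * enorm ((u j) ^~ y)|.
  rewrite [leRHS]ger0_norm ?mulr_ge0 ?enorm_ge0//.
  have := grad_supnorm_lipschitz (dg j m) (gfin j m) (\row_i u j i y) 0.
  rewrite g00 subr0; congr (_ <= _ * enorm _).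
  by apply/funext => i; rewrite !mxE subr0.
have G2 j m : inL2 (G j m) by apply: inL2_le (mG j m) (inL2Z (s j m) (mE j)) _; exact: G_le.
have Kc_sqr : Kc ^+ 2 = \sum_(m < N) k m ^+ 2.
  by rewrite sqr_sqrtr//; apply: sumr_ge0 => m _; exact: sqr_ge0.
(* Summing squares turns the [k m] into [Kc] only if [B] is common to all components; this is why
   each gradient norm is later replaced by its bound [M] or [D]. *)
have L2vnorm_le (v : 'I_N -> R -> R) (B : R) : 0 <= B ->
    (forall m, C * fine (L2norm (v m)) <= k m * B) -> C * L2vnorm v <= Kc * B.
  move=> B0 vB; rewrite -ler_sqr ?nnegrE ?mulr_ge0 ?L2vnorm_ge0 ?(ltW C0) ?(ltW Kc0)//.
  rewrite !exprMn Kc_sqr L2vnorm_sqr mulr_sumr mulr_suml; apply: ler_sum => m _.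
  rewrite -fine_L2norm_sqr -!exprMn lerXn2r ?nnegrE ?mulr_ge0 ?(ltW C0)//.
  by rewrite fine_ge0// L2norm_ge0.
have u_le j : L2vnorm (u j) <= n0 + L2vnorm (up j) by exact: L2vnormD.
have n01 : 0 < n0 + 1 by rewrite ltr_wpDl.
(* The smallness assumption on [e] restated. With [rho <= 1] it gives [sigma <= 1], with equality
   only if [n0 = 0]. *)
have sig_le : sigma * (n0 + 1) <= rho.
  have MK : 0 < M * Kc * (n0 + 1) by rewrite !mulr_gt0.
  move: ebound; rewrite ler_pdivlMr// => h.
  rewrite /sigma mulrAC ler_pdivrMr//.
  by rewrite (_ : _ * _ * _ * _ = e * (M * Kc * (n0 + 1)))//; ring.
have sig0 : 0 < sigma by rewrite divr_gt0// !mulr_gt0.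
pose w m x := up true m x - up false m x.
have w2 m : inL2 (w m) by exact: inL2B.
have -> : (fun m x => u true m x - u false m x) = w.
  by apply/funext => m; apply/funext => x; rewrite /u /w; ring.
have [sig1|sig1] := ltP sigma 1; last first.
  (* Then [sigma = 1] and [u0 = 0] a.e., so the right-hand side is [0]. *)
  have n0z : n0 = 0.
    have := le_trans sig_le rho1; have := sig1; move: n00; nra.
  have sigE : sigma = 1.
    apply/eqP; rewrite eq_le sig1 andbT; move: sig_le; rewrite n0z add0r mulr1 => h.
    exact: le_trans h rho1.
  have eMK : e * M * Kc = C by move: sigE; rewrite /sigma => /divr1_eq.
  rewrite sigE subrr invr0 mulr0 !mul0r mul0e.
  have up0 j : L2vnorm (up j) = 0.
    have u_le' : L2vnorm (u j) <= L2vnorm (up j) by have := u_le j; rewrite n0z add0r.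
    pose h m x := eps m * convol (K m) (G j m) x.
    have h2 m : inL2 (h m) by have [_ []] := up_sol j m.
    have hm m : fine (L2norm (h m)) <= k m * (e * M * L2vnorm (up j)).
      apply: (le_trans (source_bound (K1 m) (eps0 m) (G2 j m) (h2 m))).
      have GL : fine (L2norm (G j m)) <= M * L2vnorm (up j).
        apply: (le_trans (fine_L2norm_le (mG j m) (inL2Z (s j m) (mE j)) (G_le j m))).
        rewrite fine_L2normZ//; last by case: (mE j).
        by rewrite fine_L2norm_enorm// ler_pM// L2vnorm_ge0.
      rewrite [leLHS](_ : _ = k m * (eps m * fine (L2norm (G j m)))); last by rewrite /k; ring.
      rewrite ler_wpM2l// -mulrA ler_pM//.
      by rewrite fine_ge0// L2norm_ge0.
    have hsum : \sum_(m < N) fine (sqint (h m)) <= \sum_(m < N) C ^+ 2 * fine (sqint (up j m)).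
      rewrite -mulr_sumr -(L2vnorm_sqr (up j)).
      rewrite (_ : C ^+ 2 * _ = Kc ^+ 2 * (e * M * L2vnorm (up j)) ^+ 2); last first.
        by rewrite -eMK; ring.
      rewrite Kc_sqr mulr_suml; apply: ler_sum => m _.
      rewrite -fine_L2norm_sqr -exprMn lerXn2r ?nnegrE ?fine_ge0 ?L2norm_ge0//.
      by rewrite !mulr_ge0 ?L2vnorm_ge0// ltW.
    have le_m m : C ^+ 2 * fine (sqint (up j m)) <= fine (sqint (h m)).
      exact: solves_L_bound C0 (lamC m) (up_sol j m).
    (* The bound for [L] holds in each component, while [C = e * M * Kc] gave the reverse inequality
       [hsum] between the sums; hence every component has equality. *)
    have ge_m m : fine (sqint (h m)) <= C ^+ 2 * fine (sqint (up j m)).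
      move: hsum; rewrite (bigD1 m)//= [leRHS](bigD1 m)//= => hsum.
      have : \sum_(i < N | i != m) C ^+ 2 * fine (sqint (up j i)) <=
        \sum_(i < N | i != m) fine (sqint (h i)) by apply: ler_sum => i _; exact: le_m.
      move: hsum; lra.
    apply/eqP; rewrite -sqrf_eq0 L2vnorm_sqr big1// => m _.
    exact: solves_L_bound_eq0 C0 (lamC m) (up_sol j m) (ge_m m).
  have := @L2vnormD _ _ (up true) (fun m x => - up false m x) (up2 true)
    (fun m => inL2N (up2 false m)).
  by rewrite L2vnormN !up0 addr0 lee_fin.
have sig1' : 0 < 1 - sigma by rewrite subr_gt0.
have fac0 : 0 < e / (1 - sigma) * (Kc / C) * (n0 + 1) 
  by apply: mulr_gt0 => //; apply: mulr_gt0; exact: divr_gt0.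
pose d m := grad_diff_supnorm (g true m) (g false m).
have d0 m : (0 <= d m)%E by exact: supnorm_vec_ge0.
(* If some [d m] is infinite, so is the right-hand side, because its real factor is positive by
   [fac0]. *)
have [dfin|/existsNP[m /negP dm]] := pselect (forall m, (d m < +oo)%E); last first.
  have dE : d m = +oo%E by apply/eqP; move: dm; rewrite ltey negbK.
  rewrite (bigD1 m)//= -/(d m) dE addye; last first.
    by rewrite gt_eqF// (lt_le_trans ltNy0)// sume_ge0// => i _; exact: d0.
  by rewrite gt0_muley ?lte_fin// leey.
pose D := \sum_(m < N) fine (d m).
have fd0 m : 0 <= fine (d m) by exact: fine_ge0.
have D0 : 0 <= D by exact: sumr_ge0.
have dD m : fine (d m) <= D by rewrite /D (bigD1 m)//= lerDl; exact: sumr_ge0.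
have -> : (\sum_(m < N) grad_diff_supnorm (g true m) (g false m) = D%:E)%E.
  rewrite -EFin_sum_fine// => m _.
  by rewrite ge0_fin_numE; [exact: dfin|exact: d0].
rewrite -EFinM lee_fin.
pose W := L2vnorm w; pose U := L2vnorm (u false).
have W0 : 0 <= W := L2vnorm_ge0 _; have U0 : 0 <= U := L2vnorm_ge0 _.
have wE := inL2_enorm w2.
have key m : C * fine (L2norm (w m)) <= k m * (e * (M * W + D * U)).
  apply: (le_trans (source_difference_bound C0 (lamC m) (K1 m) (eps0 m)
    (G2 true m) (G2 false m) (up_sol true m) (up_sol false m))).
  rewrite [leLHS](_ : _ = k m * (eps m *
    fine (L2norm (fun x => G true m x - G false m x)))); last by rewrite /k; ring.
  rewrite ler_wpM2l// ler_pM//.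
    by rewrite fine_ge0// L2norm_ge0.
  pose B1 y := s true m * enorm (w ^~ y).
  pose B2 y := fine (d m) * enorm ((u false) ^~ y).
  have B12 : inL2 B1 by exact: inL2Z.
  have B22 : inL2 B2 by exact: inL2Z.
  apply: (@le_trans _ _ (fine (L2norm B1) + fine (L2norm B2))).
    apply: le_trans (fine_L2normD B12 B22).
    apply: fine_L2norm_le; [exact: measurable_funB|exact: inL2D|] => y.
    rewrite [leRHS]ger0_norm ?addr_ge0 ?mulr_ge0 ?enorm_ge0//.
    pose x1 : 'rV[R]_N := \row_i u true i y; pose x2 : 'rV[R]_N := \row_i u false i y.
    have -> : G true m y - G false m y =
      (g true m x1 - g true m x2) + (g true m x2 - g false m x2) by rewrite /G; ring.
    rewrite (le_trans (ler_normD _ _))// lerD//.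
      have := grad_supnorm_lipschitz (dg true m) (gfin true m) x1 x2.
      rewrite /B1; congr (_ <= _ * enorm _).
      by apply/funext => i; rewrite !mxE /u /w; ring.
    (* The difference of the two nonlinearities vanishes at [0], so its Lipschitz bound between [x2]
       and [0] controls its value at [x2]. *)
    have := grad_diff_supnorm_lipschitz (dg true m) (dg false m) (dfin m) x2 0.
    rewrite !g00 subrr subr0 /B2; congr (_ <= _ * enorm _).
    by apply/funext => i; rewrite !mxE subr0.
  rewrite !fine_L2normZ//; last 2 first.
  - by case: (mE false).
  - by case: wE.
  rewrite !fine_L2norm_enorm// lerD// ler_wpM2r//.
have {}key := L2vnorm_le w _ _ key.
have := key _; rewrite -/W => {}key.
have CW : C * W <= Kc * (e * (M * W + D * U)).
  by apply: key; rewrite mulr_ge0 ?(ltW e0)// addr_ge0// mulr_ge0// ltW.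
(* The [1] in the stated bound comes from [L2vnorm (up false) <= rho <= 1]. *)
have UU : U <= n0 + 1.
  by apply: le_trans (u_le false) _; rewrite lerD2l (le_trans (up_rho false)).
(* As [C * sigma = e * M * Kc], the term of [CW] containing [W] is absorbed into the left-hand
   side. *)
have step : (1 - sigma) * W <= e * (Kc / C) * (n0 + 1) * D.
  rewrite -(ler_pM2l C0).
  have -> : C * ((1 - sigma) * W) = C * W - Kc * (e * (M * W)).
    by rewrite /sigma; field; rewrite gt_eqF.
  have -> : C * (e * (Kc / C) * (n0 + 1) * D) = Kc * (e * (D * (n0 + 1))).
    by field; rewrite gt_eqF.
  rewrite lerBlDl (le_trans CW)// -!mulrDr ler_wpM2l ?(ltW Kc0)//.
  by rewrite ler_wpM2l ?(ltW e0)// lerD2l ler_wpM2l.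
rewrite [leRHS](_ : _ = (e * (Kc / C) * (n0 + 1) * D) / (1 - sigma)); last first.
  by rewrite -/n0; move: (1 - sigma)^-1 => z; ring.
by rewrite ler_pdivlMr// mulrC.
Qed.
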